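(* Let $E$ be a row-finite directed graph. Fix a cutting set $X$ for $E$. Define a directed graph $F$ by $$F^0 = \{\zeta(v) : v \in E^0\}, \qquad F^1 = \{\zeta(e) : e \in E^1 \setminus X\},$$ $$s(\zeta(e)) = \zeta(s(e)) \quad\text{and}\quad r(\zeta(e)) = \zeta(r(e)),$$ where $\zeta$ is a formal relabelling (injective on vertices and on edges). Then there is an isomorphism $\phi$ from $C^*(F)$ to $C^*_{\min}(E)$ such that $\phi(p_{\zeta(v)}) = p^m_v$ for all $v \in E^0$ and $\phi(s_{\zeta(e)}) = s^m_e$ for all $e \in E^1 \setminus X$.
   Context: A directed graph $E$ consists of countable sets $E^0$ (vertices) and $E^1$ (edges) and maps $r,s : E^1 \to E^0$; the edge $e$ points from $s(e)$ to $r(e)$. Write $vE^1 = r^{-1}(v)$. $E$ is row-finite if $vE^1$ is finite for every $v \in E^0$. A path is a sequence $\lambda = \lambda_1 \cdots \lambda_n$ of edges with $s(\lambda_i) = r(\lambda_{i+1})$ for $i<n$; $r(\lambda) = r(\lambda_1)$, $s(\lambda) = s(\lambda_n)$, $|\lambda| = n$ (vertices are paths of length $0$). For elements $t_e$ indexed by edges, $t_\lambda := t_{\lambda_1}\cdots t_{\lambda_n}$. A cycle is a path $\mu = \mu_1 \cdots \mu_{|\mu|}$ with $|\mu| \ge 1$, $r(\mu) = s(\mu)$ and $s(\mu_i) \ne s(\mu_j)$ for $i<j$. It has no entrance in $E$ if $e \in E^1$ and $r(e) = r(\mu_i)$ imply $e = \mu_i$, for all $i$. For a cycle $\mu$, $[\mu]$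 is the set of its cyclic permutations and $[\mu]^1 = \{\mu_i : 1 \le i \le |\mu|\}$. $C(E)$ is the set of all $[\mu]$ where $\mu$ is a cycle with no entrance in $E$, and $C(E)^1 = \bigcup_{C \in C(E)} C^1$. A cutting set for $E$ is a subset $X \subset C(E)^1$ such that $X \cap C^1$ is a singleton for each $C \in C(E)$. A Toeplitz-Cuntz-Krieger $E$-family in a $C^*$-algebra consists of elements $\{p_v : v \in E^0\}$, $\{s_e : e \in E^1\}$ such that (T1) the $p_v$ are mutually orthogonal projections; (T2) $s_e^* s_e = p_{s(e)}$ for all $e \in E^1$; (T3) $p_v \ge \sum_{e \in G} s_e s_e^*$ for all $v \in E^0$ and finite $G \subset r^{-1}(v)$. It is a Cuntz-Krieger $E$-family if moreover (CK) $p_v = \sum_{r(e)=v} s_e s_e^*$ whenever $0 < |r^{-1}(v)| < \infty$. A normalised reduced Cuntz-Krieger $E$-family is a Cuntz-Krieger $E$-family such that $s_\mu = p_{r(\mu)}$ for each cycle $\mu$ with no entrance in $E$. For a directed graph $F$, $C^*(F)$ is the universal $C^*$-algebra generated by a Cuntz-Krieger $F$-family, with universal generators $\{p_w : w \in F^0\}$, $\{s_f : f \in F^1\}$. $C^*_{\min}(E)$ denotes the co-universal $C^*$-algebra of $E$ (existing for row-finite $E$, and unique up to isomorphism): it is generated by a normalised reduced Cuntz-Krieger $E$-family $\{p^m_v : v \in E^0\}$, $\{s^m_e : e \in E^1\}$ such that (a) every $p^m_v$ is nonzero; (b) given any Toeplitz-Cuntz-Krieger $E$-family $\{q_v\}, \{t_e\}$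 in a $C^*$-algebra with each $q_v \ne 0$ and any cutting set $X$ for $E$, there are a function $\kappa : X \to \mathbb{T}$ and a homomorphism $\psi_{q,t} : C^*(\{q_v, t_e : v \in E^0, e \in E^1\}) \to C^*_{\min}(E)$ with $\psi_{q,t}(q_v) = p^m_v$ for all $v \in E^0$, $\psi_{q,t}(t_e) = s^m_e$ for all $e \in E^1 \setminus X$, and $\psi_{q,t}(t_x) = \kappa(x) s^m_x$ for all $x \in X$. *)

(* Defs.v *)
From HB Require Import structures.
From mathcomp Require Import all_boot all_order all_algebra.
From mathcomp Require Import complex.
From mathcomp Require Import all_classical all_reals.
From mathcomp Require Import topology normedtype.

Set Implicit Arguments.
Unset Strict Implicit.
Unset Printing Implicit Defensive.

Import Order.TTheory GRing.Theory Num.Theory.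
Import numFieldNormedType.Exports.

Local Open Scope classical_set_scope.
Local Open Scope ring_scope.
Local Open Scope complex_scope.

(* C*-algebras are not assumed to be unital.  The scalars are the complex
   numbers R[i]; norms take their values in R[i], where [a <= b] means that
   [b - a] is a nonnegative real, and scalars are conjugated by [^*%C]. *)
HB.mixin Record isCStarAlgebra (R : realType) A
    of CompleteNormedModule R[i] A := {
  cmul : A -> A -> A ;
  cstar : A -> A ;
  cmulA : forall x y z, cmul x (cmul y z) = cmul (cmul x y) z ;
  cmulDl : forall x y z, cmul (x + y) z = cmul x z + cmul y z ;
  cmulDr : forall x y z, cmul x (y + z) = cmul x y + cmul x z ;
  cmulZl : forall (a : R[i]) x y, cmul (a *: x) y = a *: cmul x y ;
  cmulZr : forall (a : R[i]) x y, cmul x (a *: y) = a *: cmul x y ;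
  cstarK : forall x, cstar (cstar x) = x ;
  cstarD : forall x y, cstar (x + y) = cstar x + cstar y ;
  cstarZ : forall (a : R[i]) x, cstar (a *: x) = (a^*)%C *: cstar x ;
  cstarM : forall x y, cstar (cmul x y) = cmul (cstar y) (cstar x) ;
  cnormM : forall x y, `|cmul x y| <= `|x| * `|y| ;
  cnorm_star : forall x, `|cmul (cstar x) x| = `|x| ^+ 2
}.

#[short(type="cstarAlgType")]
HB.structure Definition CStarAlgebra (R : realType) :=
  { A of CompleteNormedModule R[i] A & isCStarAlgebra R A }.

Notation "x ** y" := (cmul x y) (at level 40, left associativity) : ring_scope.

Section CStar.
Variable R : realType.
Implicit Types A B : cstarAlgType R.

Definition projection A (p : A) : Prop := p ** p = p /\ cstar p = p.

(* The order-theoretic cone of a C*-algebra: elements of the form a^* a. *)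
Definition cpositive A (x : A) : Prop := exists a, x = cstar a ** a.

Definition cle A (x y : A) : Prop := cpositive (y - x).

Definition sub_cstar A (D : set A) : Prop :=
  D 0 /\
  (forall x y, D x -> D y -> D (x + y)) /\
  (forall (a : R[i]) x, D x -> D (a *: x)) /\
  (forall x y, D x -> D y -> D (x ** y)) /\
  (forall x, D x -> D (cstar x)) /\
  closed D.

Definition cstar_gen A (S : set A) : set A :=
  \bigcap_(D in [set D | sub_cstar D /\ S `<=` D]) D.

(* [f] restricts to a homomorphism on the sub-C*-algebra [D]; its values
   outside [D] are irrelevant. *)
Definition star_hom_on A B (D : set A) (f : A -> B) : Prop :=
  (forall x y, D x -> D y -> f (x + y) = f x + f y) /\
  (forall (a : R[i]) x, D x -> f (a *: x) = a *: f x) /\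
  (forall x y, D x -> D y -> f (x ** y) = f x ** f y) /\
  (forall x, D x -> f (cstar x) = cstar (f x)).

Definition star_hom A B (f : A -> B) : Prop := star_hom_on setT f.

Definition star_iso A B (f : A -> B) : Prop := star_hom f /\ bijective f.

End CStar.

Record digraph := Digraph {
  vert : countType ;
  edge : countType ;
  rng : edge -> vert ;
  src : edge -> vert }.

Definition row_finite (E : digraph) : Prop :=
  forall v : vert E, finite_set [set e : edge E | rng e = v].

Section Cycles.
Variable E : digraph.
Implicit Types (mu : seq (edge E)) (X : set (edge E)).

(* Paths are composed right to left, as in s(mu_i) = r(mu_{i+1}); the
   predicate [cycle] also contains the wrap-around condition
   s(mu_n) = r(mu_1), that is s(mu) = r(mu). *)
Definition is_cycle mu : Prop :=
  [/\ mu != [::], cycle (fun e f : edge E => src e == rng f) mu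
    & uniq [seq src e | e <- mu]].

Definition no_entrance mu : Prop :=
  forall e f : edge E, f \in mu -> rng e = rng f -> e = f.

Definition cycle_class mu : set (seq (edge E)) :=
  [set nu | exists n, nu = rot n mu].

Definition cycles_no_entrance : set (set (seq (edge E))) :=
  [set C | exists mu, [/\ is_cycle mu, no_entrance mu & C = cycle_class mu]].

Definition class_edges (C : set (seq (edge E))) : set (edge E) :=
  [set e | exists2 mu, C mu & e \in mu].

Definition cutting_set X : Prop :=
  X `<=` \bigcup_(C in cycles_no_entrance) class_edges C /\
  forall C, cycles_no_entrance C -> exists x, X `&` class_edges C = [set x].

End Cycles.

Section Families.
Variables (R : realType) (E : digraph).

Section Family.
Variables (A : cstarAlgType R) (p : vert E -> A) (s : edge E -> A).

Definition TCK_family : Prop :=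
  [/\ (forall v, projection (p v)) /\
      (forall v w, v <> w -> p v ** p w = 0),
      (forall e, cstar (s e) ** s e = p (src e))
    & (forall v (G : set (edge E)), finite_set G ->
         G `<=` [set e | rng e = v] ->
         cle (\sum_(e \in G) (s e ** cstar (s e))) (p v))].

Definition CK_family : Prop :=
  TCK_family /\
  (forall v, [set e : edge E | rng e = v] !=set0 ->
     finite_set [set e : edge E | rng e = v] ->
     p v = \sum_(e \in [set e | rng e = v]) (s e ** cstar (s e))).

(* s_{e mu} = s_e s_{mu_1} ... s_{mu_n} *)
Definition path_elt (e : edge E) (mu : seq (edge E)) : A :=
  foldl (@cmul R A) (s e) [seq s f | f <- mu].

Definition normalised_reduced_CK_family : Prop :=
  CK_family /\
  forall e mu, is_cycle (e :: mu) -> no_entrance (e :: mu) ->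
    path_elt e mu = p (rng e).

Definition family_cstar : set A := cstar_gen (range p `|` range s).

End Family.

(* C*(E), specified up to isomorphism by its universal property. *)
Definition graph_cstar (A : cstarAlgType R)
    (p : vert E -> A) (s : edge E -> A) : Prop :=
  [/\ CK_family p s,
      family_cstar p s = setT
    & forall (B : cstarAlgType R) (q : vert E -> B) (t : edge E -> B),
        CK_family q t ->
        exists pi : A -> B,
          [/\ star_hom pi, (forall v, pi (p v) = q v)
            & (forall e, pi (s e) = t e)]].

(* C*_min(E), specified up to isomorphism by its co-universal property. *)
Definition co_universal_cstar (A : cstarAlgType R)
    (pm : vert E -> A) (sm : edge E -> A) : Prop :=
  [/\ normalised_reduced_CK_family pm sm,
      family_cstar pm sm = setT,
      (forall v, pm v <> 0)
    & forall (B : cstarAlgType R) (q : vert E -> B) (t : edge E -> B)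
             (X : set (edge E)),
        TCK_family q t -> (forall v, q v <> 0) -> cutting_set X ->
        exists (kappa : edge E -> R[i]) (psi : B -> A),
          [/\ (forall x, X x -> `|kappa x| = 1),
              star_hom_on (family_cstar q t) psi,
              (forall v, psi (q v) = pm v),
              (forall e, ~ X e -> psi (t e) = sm e)
            & (forall x, X x -> psi (t x) = kappa x *: sm x)]].

End Families.

Section CutGraph.
Variables (E : digraph) (X : set (edge E)).

Definition cut_graph : digraph :=
  @Digraph (vert E) {e : edge E | e \notin X}
    (fun f => rng (val f)) (fun f => src (val f)).

Definition zeta_vert (v : vert E) : vert cut_graph := v.

Definition zeta_edge (e : edge E) (he : e \notin X) : edge cut_graph :=
  Sub e he.

End CutGraph.

(* Main.v *)
Require Import Defs.
From HB Require Import structures.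
From mathcomp Require Import all_boot all_order all_algebra.
From mathcomp Require Import complex.
From mathcomp Require Import all_classical all_reals.
From mathcomp Require Import topology normedtype.
From mathcomp Require Import ring lra zify.

Set Implicit Arguments.
Unset Strict Implicit.
Unset Printing Implicit Defensive.

Import Order.TTheory GRing.Theory Num.Theory.
Import numFieldNormedType.Exports.

Local Open Scope classical_set_scope.
Local Open Scope ring_scope.
Local Open Scope complex_scope.

(** Why the theorem holds.  Cutting one edge out of every entranceless cycle
    leaves a graph [F] in which every cycle has an entrance.  In [C*_min(E)] the
    remaining generators form a Cuntz-Krieger [F]-family with nonzero vertex
    projections: a vertex that receives an edge of [F] receives no cut edge, so
    the relation at that vertex is the one of [E].  This gives a homomorphism
    [phi] from [C*(F)].  It is onto because the normalisation [s_x s_mu = p]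
    around a cut cycle [x mu] recovers [s_x] as [s_mu^*].  It is isometric by
    the Cuntz-Krieger uniqueness theorem, [cuntz_krieger_uniqueness], which is
    the substance of the proof.

    The uniqueness theorem is proved here without integrating a gauge action and
    without spectral theory.  One principle replaces both: if
    [|a| <= C |phi a|] on a family of elements stable under powers of [a^* a],
    with [C] growing slower than exponentially in the exponent, then
    [|a| <= |phi a|], because [|h ^ (2 ^ j)| = |h| ^ (2 ^ j)] for self-adjoint
    [h] ([le_of_growth]).
    - Matrix units ([matrix_units_nrm_le]): over a finite index set the
      coefficients of an element are bounded by its norm, so up to the number of
      coefficients the norm is the same in all systems of nonzero matrix units;
      by the principle the norms agree.
    - Diagonal part ([nrm_graded0_le]): in the span of the [s_mu s_nu^*] with
      lengths at most [n], the part [a0] of degree 0 satisfies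
      [|a0| <= |phi (a0 + a1)|] for [a1] without degree 0 component.  Indeed
      each vertex [w] has a path [lam] that no closed path of length at most [n]
      at [w] shifts onto itself ([exists_aperiodic_path], where entrances are
      used), and compressing by the projections [s_(mu lam) s_(mu lam)^*] kills
      [phi a1] while it turns [phi a0] into the same matrix over other matrix
      units.
    - Isometry ([hom_level_isometric]): applied to [b^* a] for each homogeneous
      component [b] of [a], this gives [|b| <= |phi a|], hence
      [|a| <= (2 n + 1) |phi a|], and the constant only doubles with the
      exponent.

    The facts about C*-algebras that are needed are obtained from one
    construction, the cosine of a self-adjoint element ([exists_cosine]):
    homomorphisms are contractive ([hom_contractive]), and
    [x^* x + y^* y = 0] forces [x = y = 0] ([sum_squares_eq0]), which turns the
    Toeplitz inequality into the relations [p_(r(e)) s_e = s_e] and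
    [s_e^* s_f = 0]. *)

(** * Equations in abelian groups *)

Section ZmodDecision.

Inductive zterm := ZVar of nat | ZAdd of zterm & zterm | ZOpp of zterm | ZZero.

Fixpoint zeval (V : zmodType) (env : seq V) t : V :=
  match t with
  | ZVar i => env`_i
  | ZAdd t1 t2 => zeval env t1 + zeval env t2
  | ZOpp t1 => - zeval env t1
  | ZZero => 0
  end.

Fixpoint zcoef t (i : nat) : int :=
  match t with
  | ZVar j => (i == j)%:Z
  | ZAdd t1 t2 => zcoef t1 i + zcoef t2 i
  | ZOpp t1 => - zcoef t1 i
  | ZZero => 0
  end.

Lemma zevalE (V : zmodType) (env : seq V) t :
  zeval env t = \sum_(i < size env) env`_i *~ zcoef t i.
Proof.
elim: t => [j|t1 IH1 t2 IH2|t1 IH1|] /=.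
- have [jn|nj] := ltnP j (size env); last first.
    rewrite nth_default // big1 // => i _.
    by rewrite (ltn_eqF (leq_trans (ltn_ord i) nj)) mulr0z.
  rewrite (bigD1 (Ordinal jn)) //= eqxx mulr1z big1 ?addr0 // => i.
  by rewrite -val_eqE /= => /negPf ->; rewrite mulr0z.
- by rewrite IH1 IH2 -big_split; apply: eq_bigr => i _; rewrite mulrzDr.
- by rewrite IH1 -sumrN; apply: eq_bigr => i _; rewrite mulrNz.
- by rewrite big1.
Qed.

Lemma zeval_eq (V : zmodType) (env : seq V) t1 t2 :
  all (fun i => zcoef t1 i == zcoef t2 i) (iota 0 (size env)) ->
  zeval env t1 = zeval env t2.
Proof.
move=> /allP t12; rewrite !zevalE; apply: eq_bigr => i _.
by rewrite (eqP (t12 _ _)) // mem_iota ltn_ord.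
Qed.

End ZmodDecision.

(* Atoms are compared up to conversion: one scaling or product may be stated
   through several instances of the algebraic structures. *)
Ltac zindex x env :=
  match env with
  | ?y :: _ => let _ := constr:(erefl x : x = y) in constr:(0%N)
  | _ :: ?env' => let i := zindex x env' in constr:(i.+1)
  end.
Ltac zinsert x env :=
  match env with
  | _ => let _ := zindex x env in env
  | _ => constr:(x :: env)
  end.
Ltac zatoms t env :=
  lazymatch t with
  | @GRing.add _ ?a ?b => let env' := zatoms a env in zatoms b env'
  | @GRing.opp _ ?a => zatoms a env
  | @GRing.zero _ => env
  | _ => zinsert t env
  end.
Ltac zreify t env :=
  lazymatch t with
  | @GRing.add _ ?a ?b =>
      let a' := zreify a env in let b' := zreify b env in constr:(ZAdd a' b')
  | @GRing.opp _ ?a => let a' := zreify a env in constr:(ZOpp a')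
  | @GRing.zero _ => constr:(ZZero)
  | _ => let i := zindex t env in constr:(ZVar i)
  end.

(** Proves an equation between sums of opposites in an abelian group. *)
Ltac abel :=
  lazymatch goal with
  | |- @eq ?V ?a ?b =>
      let env := zatoms a (@nil V) in
      let env := zatoms b env in
      let a' := zreify a env in
      let b' := zreify b env in
      let H := fresh in
      have H := @zeval_eq _ env a' b' isT; cbn [zeval nth] in H; exact H
  end.

(** * Real-valued norms and the algebraic operations *)

Section RealNorm.
Variable R : realType.
Implicit Types (V : normedZmodType R[i]) (r : R).

(** The norms of the algebras take their values in [R[i]], where the order is
    partial; their real parts can be compared by arithmetic in [R]. *)
Definition nrm V (x : V) : R := complex.Re `|x|.

Lemma normE V (x : V) : `|x| = (nrm x)%:C.
Proof. by rewrite /nrm RRe_real // ger0_real. Qed.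

Lemma nrm_ge0 V (x : V) : 0 <= nrm x.
Proof. by rewrite -ler0c -normE. Qed.

Lemma nrm0 V : nrm (0 : V) = 0.
Proof. by rewrite /nrm normr0. Qed.

Lemma nrm_eq0 V (x : V) : (nrm x == 0) = (x == 0).
Proof. by rewrite -[RHS]normr_eq0 normE -(inj_eq (@complexI R)). Qed.

Lemma nrm_gt0 V (x : V) : (0 < nrm x) = (x != 0).
Proof. by rewrite lt_def nrm_ge0 andbT nrm_eq0. Qed.

Lemma nrmN V (x : V) : nrm (- x) = nrm x.
Proof. by rewrite /nrm normrN. Qed.

Lemma nrmBC V (x y : V) : nrm (x - y) = nrm (y - x).
Proof. by rewrite -nrmN opprB. Qed.

Lemma nrmD V (x y : V) : nrm (x + y) <= nrm x + nrm y.
Proof.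
have := ler_normD x y; rewrite !normE -rmorphD /= lecR; exact.
Qed.

Lemma nrm_sum V (I : Type) (r : seq I) (P : pred I) (F : I -> V) :
  nrm (\sum_(i <- r | P i) F i) <= \sum_(i <- r | P i) nrm (F i).
Proof.
elim/big_rec2: _ => [|i y x _ le_xy]; first by rewrite nrm0.
by apply: le_trans (nrmD _ _) _; rewrite lerD2l.
Qed.

Lemma nrmR r : nrm r%:C = `|r|.
Proof. by rewrite /nrm normc_def /= expr0n addr0 sqrtr_sqr. Qed.

Lemma nrmn n : nrm (n%:R : R[i]) = n%:R.
Proof. by rewrite -(rmorph_nat (real_complex R)) nrmR ger0_norm ?ler0n. Qed.

Lemma nrmi : nrm ('i%C : R[i]) = 1.
Proof. by rewrite /nrm normc_def /= expr0n add0r expr1n sqrtr1. Qed.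

Lemma conjNi : ((- 'i%C)^*)%C = - - 'i%C :> R[i].
Proof. by apply/eqP; rewrite eq_complex /= ?oppr0 ?opprK ?eqxx. Qed.

Lemma conji : ('i%C^*)%C = - 'i%C :> R[i].
Proof. by apply/eqP; rewrite eq_complex /= oppr0 !eqxx. Qed.

Lemma mulii : 'i%C * 'i%C = -1 :> R[i].
Proof. by rewrite -expr2 sqr_i. Qed.

Lemma nrmZ (V : normedModType R[i]) (a : R[i]) (x : V) :
  nrm (a *: x) = nrm a * nrm x.
Proof. by apply: complexI; rewrite rmorphM /= -!normE normrZ. Qed.

End RealNorm.

Section Algebra.
Variables (R : realType) (A : cstarAlgType R).
Implicit Types (x y z a b g : A) (c : R[i]).

Lemma cmul0l x : 0 ** x = 0.
Proof. by rewrite -(scale0r (0 : A)) cmulZl !scale0r. Qed.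
Lemma cmul0r x : x ** 0 = 0.
Proof. by rewrite -(scale0r (0 : A)) cmulZr !scale0r. Qed.
Lemma cmulNl x y : (- x) ** y = - (x ** y).
Proof. by rewrite -scaleN1r cmulZl scaleN1r. Qed.
Lemma cmulNr x y : x ** (- y) = - (x ** y).
Proof. by rewrite -scaleN1r cmulZr scaleN1r. Qed.
Lemma cmulBl x y z : (x - y) ** z = x ** z - y ** z.
Proof. by rewrite cmulDl cmulNl. Qed.
Lemma cmulBr x y z : x ** (y - z) = x ** y - x ** z.
Proof. by rewrite cmulDr cmulNr. Qed.
Lemma cstar0 : cstar (0 : A) = 0.
Proof. by rewrite -(scale0r (0 : A)) cstarZ conjc0 !scale0r. Qed.
Lemma cstarN x : cstar (- x) = - cstar x.
Proof. by rewrite -scaleN1r cstarZ rmorphN rmorph1 scaleN1r. Qed.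
Lemma cstarB x y : cstar (x - y) = cstar x - cstar y.
Proof. by rewrite cstarD cstarN. Qed.

Lemma cmul_suml (I : Type) (r : seq I) (P : pred I) (F : I -> A) x :
  (\sum_(i <- r | P i) F i) ** x = \sum_(i <- r | P i) F i ** x.
Proof.
exact: (big_morph (fun y => y ** x) (fun y z => cmulDl y z x) (cmul0l x)).
Qed.
Lemma cmul_sumr (I : Type) (r : seq I) (P : pred I) (F : I -> A) x :
  x ** (\sum_(i <- r | P i) F i) = \sum_(i <- r | P i) x ** F i.
Proof. exact: (big_morph (cmul x) (cmulDr x) (cmul0r x)). Qed.
Lemma cstar_sum (I : Type) (r : seq I) (P : pred I) (F : I -> A) :
  cstar (\sum_(i <- r | P i) F i) = \sum_(i <- r | P i) cstar (F i).
Proof. exact: (big_morph (@cstar R A) (@cstarD R A) cstar0). Qed.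

Lemma half_add x : (2^-1 : R[i]) *: x + (2^-1 : R[i]) *: x = x.
Proof.
have half2 : (2^-1 + 2^-1 : R[i]) = 1 by field.
by rewrite -scalerDl half2 scale1r.
Qed.

Lemma nrm_half x : nrm ((2^-1 : R[i]) *: x) = 2^-1 * nrm x.
Proof.
have : nrm ((2 : R[i]) *: ((2^-1 : R[i]) *: x)) = nrm x.
  by rewrite scalerA divff ?scale1r ?pnatr_eq0.
by rewrite nrmZ nrmn; lra.
Qed.

Lemma nrmM x y : nrm (x ** y) <= nrm x * nrm y.
Proof. by have := cnormM x y; rewrite !normE -rmorphM /= lecR. Qed.

Lemma nrm_starM x : nrm (cstar x ** x) = nrm x ^+ 2.
Proof. by apply: complexI; rewrite -normE cnorm_star normE rmorphXn. Qed.

Lemma nrm_star x : nrm (cstar x) = nrm x.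
Proof.
have H z : nrm z <= nrm (cstar z).
  have [->|z0] := eqVneq z 0; first by rewrite cstar0 lexx.
  have : 0 < nrm z by rewrite nrm_gt0.
  by move=> z1; rewrite -(ler_pM2r z1) -expr2 -nrm_starM nrmM.
by apply/le_anti; rewrite H -{2}(cstarK x) H.
Qed.

Lemma nrm_Mstar x : nrm (x ** cstar x) = nrm x ^+ 2.
Proof. by rewrite -{1}(cstarK x) nrm_starM nrm_star. Qed.

Lemma starM_eq0 x : cstar x ** x = 0 -> x = 0.
Proof.
move=> x0; apply/eqP; rewrite -nrm_eq0 -sqrf_eq0 -nrm_starM x0.
by rewrite nrm0.
Qed.

(** When [y^* w] is self-adjoint the cross terms of [y + c w] cancel for
    [c = i] and [c = - i]. *)
Lemma nrm_rotation y w N c : cstar y ** w = cstar w ** y ->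
  nrm (cstar y ** y + cstar w ** w) = N ^+ 2 -> 0 <= N ->
  (c^*)%C = - c -> c * c = -1 -> nrm (y + c *: w) = N.
Proof.
move=> yw yyww N0 cc c1; apply/eqP; rewrite -(eqrXn2 (n := 2)) ?nrm_ge0 //.
rewrite -nrm_starM -yyww cstarD cstarZ cc cmulDl !cmulDr.
rewrite !cmulZl !cmulZr scalerA mulNr c1 opprK scale1r yw.
by rewrite scaleNr addrA addrK.
Qed.

End Algebra.

(** * Limits and growth *)

Section Limits.
Variable R : realType.

Lemma bernoulli_le (d : R) n : 0 <= d -> 1 + n%:R * d <= (1 + d) ^+ n.
Proof.
move=> d0; elim: n => [|n IH]; first by rewrite mul0r addr0 expr0.
have n0 : 0 <= n%:R :> R by [].
by rewrite exprS -natr1; nra.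
Qed.

Lemma expr_lt_eps (r e : R) : 0 <= r -> r < 1 -> 0 < e ->
  exists n, forall m, (n <= m)%N -> r ^+ m < e.
Proof.
move=> r0 r1 e0; have [->|rn0] := eqVneq r 0.
  by exists 1%N => -[//|m] _; rewrite expr0n.
have rp : 0 < r by rewrite lt_def rn0.
have d0 : 0 < r^-1 - 1 by rewrite subr_gt0 invf_gt1.
exists (Num.truncn (e^-1 / (r^-1 - 1))).+1 => m nm.
rewrite -[r]invrK exprVn invf_plt ?posrE ?exprn_gt0 ?invr_gt0 //.
rewrite -[r^-1](subrKC 1); apply: lt_le_trans (bernoulli_le m (ltW d0)).
have : e^-1 / (r^-1 - 1) < m%:R.
  by apply: lt_le_trans (truncnS_gt _) _; rewrite ler_nat.
by rewrite ltr_pdivrMr // => H; lra.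
Qed.

(** Were [a > b], the quotient [(a / b) ^ (2 ^ j)] would grow faster than
    [2 ^ j]. *)
Lemma le_of_growth (a b C : R) : 0 <= b ->
  (forall j, a ^+ (2 ^ j) <= C * 2 ^+ j * b ^+ (2 ^ j)) -> a <= b.
Proof.
move=> b0 H; rewrite leNgt; apply/negP => ab.
have [b1|bn0] := eqVneq b 0.
  by have := H 0; rewrite b1 /= expn0 !expr1 mulr0; lra.
have bp : 0 < b by rewrite lt_def bn0.
pose d := a / b - 1.
have d0 : 0 < d by rewrite subr_gt0 ltr_pdivlMr ?mul1r.
have H1 j : (1 + d) ^+ (2 ^ j) <= C * 2 ^+ j.
  by rewrite subrKC expr_div_n ler_pdivrMr ?exprn_gt0.
have H2 j : 2 ^+ j * d ^+ 2 <= 2 * C.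
  have := H1 j.+1; rewrite expnS mulnC exprM.
  have := bernoulli_le (2 ^ j) (ltW d0).
  rewrite natrX (exprS 2 j) => B1 B2.
  have p2 : 0 < 2 ^+ j :> R by rewrite exprn_gt0.
  have : (2 ^+ j * d) ^+ 2 <= C * (2 * 2 ^+ j).
    apply: le_trans B2; rewrite ler_sqr ?nnegrE; last 1 first.
    - by rewrite exprn_ge0 //; lra.
    - by lra.
    by rewrite mulr_ge0 // ltW.
  rewrite exprMn => B3; rewrite -(ler_pM2l p2); nra.
have [n Hn] : exists n, 2 * C / d ^+ 2 < n%:R.
  by exists (Num.truncn (2 * C / d ^+ 2)).+1; exact: truncnS_gt.
have := H2 n; rewrite -ler_pdivlMr ?exprn_gt0 // => H3.
have : n%:R < 2 ^+ n :> R by rewrite -natrX ltr_nat ltn_expl.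
by lra.
Qed.

Lemma cauchy_limit (V : completeNormedModType R[i]) (u : nat -> V) :
  (forall e : R, 0 < e ->
     exists N, forall n, (N <= n)%N -> nrm (u n - u N) < e) ->
  exists l, forall e : R, 0 < e ->
     exists N, forall n, (N <= n)%N -> nrm (u n - l) < e.
Proof.
move=> uc; have ltnrm (x : V) (e : R) : (`|x| < e%:C) = (nrm x < e).
  by rewrite normE ltcR.
have posC (e : R[i]) : 0 < e -> exists2 e', 0 < e' & e = e'%:C.
  move=> e0; have eE := RRe_real (gtr0_real e0).
  by exists (complex.Re e); rewrite ?eE // -ltcR eE.
have : cauchy (u @ \oo).
  apply: cauchy_exP => _ /posC[e e0 ->]; have [N uN] := uc e e0.
  exists (u N); exists N => // n /= Nn.
  by rewrite -ball_normE /= distrC ltnrm uN.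
move=> /cauchy_cvg /cvg_ex [l ul]; exists l => e e0.
have e0C : 0 < e%:C by rewrite ltcR.
move/cvgrPdist_lt/(_ _ e0C): ul => [N _ uN].
by exists N => n /uN; rewrite /= distrC ltnrm.
Qed.

Lemma nrm_small_eq0 (V : normedZmodType R[i]) (x : V) (C : R) :
  (forall e, 0 < e -> nrm x <= C * e) -> x = 0.
Proof.
move=> H; apply/eqP; rewrite -nrm_eq0; apply/eqP/le_anti.
rewrite nrm_ge0 andbT leNgt; apply/negP => x0.
have e0 : 0 < nrm x / (2 * (`|C| + 1)).
  by rewrite divr_gt0 // mulr_gt0 // ltr_wpDl.
have := H _ e0; rewrite mulrA ler_pdivlMr; last by rewrite mulr_gt0 // ltr_wpDl.
have := ler_norm C; have := normr_ge0 C; nra.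
Qed.

End Limits.

(** * Cosines of self-adjoint elements *)

Section SelfAdjoint.
Variables (R : realType) (A : cstarAlgType R).
Implicit Types (x y z a b g : A) (c : R[i]).

Definition selfadj x := cstar x = x.

Lemma selfadj_starM x : selfadj (cstar x ** x).
Proof. by rewrite /selfadj cstarM cstarK. Qed.

Definition sqs j x := iter j (fun y => y ** y) x.

Lemma nrm_sqs j x : selfadj x ->
  selfadj (sqs j x) /\ nrm (sqs j x) = nrm x ^+ (2 ^ j).
Proof.
move=> xs; elim: j => [|j [IHs IH]]; first by rewrite expn0 expr1.
split; first by rewrite /= /selfadj cstarM IHs.
by rewrite /= -{1}IHs nrm_starM IH -exprM expnS mulnC.
Qed.

(** The sine [a] of norm below 1 has a cosine [1 - b]; the unit is only
    formal here, and the defining equation [(1 - b)^2 = 1 - a^2] is solved by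
    iterating the contraction [b -> (a^2 + b^2) / 2]. *)
Lemma exists_cosine a : selfadj a -> nrm a < 1 ->
  exists b, [/\ selfadj b, a ** b = b ** a & a ** a = b + b - b ** b].
Proof.
move=> asa a1; set r := nrm a in a1.
have r0 : 0 <= r := nrm_ge0 a.
pose f b := (2^-1 : R[i]) *: (a ** a + b ** b).
pose u n := iter n f 0.
have ur n : nrm (u n) <= r.
  elim: n => [|n IH]; first by rewrite /u /= nrm0.
  rewrite /u iterS -/(u n) nrm_half.
  have := nrmD (a ** a) (u n ** u n); have := nrmM a a.
  have := nrmM (u n) (u n); have := nrm_ge0 (u n); rewrite -/r; nra.
have us n : selfadj (u n).
  elim: n => [|n IH]; first exact: cstar0.
  rewrite /u iterS -/(u n) /f /selfadj cstarZ cstarD !cstarM asa IH.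
  by rewrite fmorphV rmorph_nat.
have ua n : a ** u n = u n ** a.
  elim: n => [|n IH]; first by rewrite cmul0l cmul0r.
  rewrite /u iterS -/(u n) /f cmulZr cmulZl cmulDr cmulDl !cmulA IH.
  by rewrite -!cmulA IH.
have ud n : nrm (u n.+1 - u n) <= r ^+ n.
  elim: n => [|n IH].
    apply: le_trans (nrmD _ _) _; rewrite nrmN nrm0 addr0 expr0.
    exact: le_trans (ur 1%N) (ltW a1).
  have -> : u n.+2 - u n.+1 =
      (2^-1 : R[i]) *: (u n.+1 ** (u n.+1 - u n) + (u n.+1 - u n) ** u n).
    rewrite cmulBl cmulBr addrA subrK {1 2}/u iterS (iterS n).
    rewrite -/(u n.+1) -/(u n).
    by rewrite /f -scalerBr opprD addrACA subrr add0r.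
  rewrite nrm_half exprS.
  have := nrmD (u n.+1 ** (u n.+1 - u n)) ((u n.+1 - u n) ** u n).
  have := nrmM (u n.+1) (u n.+1 - u n); have := nrmM (u n.+1 - u n) (u n).
  have := ur n; have := ur n.+1; have := nrm_ge0 (u n.+1 - u n); nra.
have uk N k : (1 - r) * nrm (u (N + k)%N - u N) <= r ^+ N - r ^+ (N + k).
  elim: k => [|k IH]; first by rewrite addn0 !subrr nrm0 mulr0.
  have := nrmD (u (N + k.+1)%N - u (N + k)%N) (u (N + k)%N - u N).
  rewrite addrA subrK addnS exprS; have := ud (N + k)%N; nra.
have [e e0|b ub] := @cauchy_limit R A u.
  have e1 : 0 < (1 - r) * e by nra.
  have [N rN] := expr_lt_eps r0 a1 e1; exists N => n Nn.
  have := uk N (n - N)%N; rewrite subnKC //; have := rN _ (leqnn N).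
  have : 0 <= r ^+ n by rewrite exprn_ge0.
  by move=> *; rewrite -(@ltr_pM2l _ (1 - r)); lra.
exists b; split.
- apply/eqP; rewrite -subr_eq0; apply/eqP.
  apply: (@nrm_small_eq0 R A _ 2) => e /ub[N /(_ _ (leqnn N)) uN].
  rewrite -(subrK (u N) (cstar b)) -{1}us -cstarB -addrA.
  by apply: le_trans (nrmD _ _) _; rewrite nrm_star nrmBC; lra.
- apply/eqP; rewrite -subr_eq0; apply/eqP.
  apply: (@nrm_small_eq0 R A _ (2 * r)) => e /ub[N /(_ _ (leqnn N)) uN].
  have -> : a ** b - b ** a = (u N - b) ** a - a ** (u N - b).
    by rewrite cmulBl cmulBr ua; abel.
  apply: le_trans (nrmD _ _) _; rewrite nrmN.
  have := nrmM a (u N - b); have := nrmM (u N - b) a.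
  have := nrm_ge0 (u N - b); rewrite -/r; nra.
- apply/eqP; rewrite -subr_eq0; apply/eqP.
  apply: (@nrm_small_eq0 R A _ (2 + r + nrm b)) => e /ub[N uN].
  have := uN N.+1 (leqnSn N); have := uN N (leqnn N); set w := u N - b => w1 w2.
  have E : u N.+1 + u N.+1 = a ** a + u N ** u N.
    by rewrite /u iterS -/(u N) half_add.
  have -> : a ** a - (b + b - b ** b) =
     ((u N.+1 - b) + (u N.+1 - b)) - (u N ** w + w ** b).
    rewrite addrACA E /w cmulBr cmulBl; abel.
  have := nrmD ((u N.+1 - b) + (u N.+1 - b)) (- (u N ** w + w ** b)).
  rewrite nrmN; have := nrmD (u N ** w) (w ** b).
  have := nrmD (u N.+1 - b) (u N.+1 - b).
  have := nrmM (u N) w; have := nrmM w b; have := ur N.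
  have := nrm_ge0 b; have := nrm_ge0 w; have := nrm_ge0 (u N); nra.
Qed.
End SelfAdjoint.

Section Cosine.
Variables (R : realType) (A : cstarAlgType R) (a b : A).
Hypotheses (asa : selfadj a) (bsa : selfadj b) (ab : a ** b = b ** a).
Hypothesis cosE : a ** a = b + b - b ** b.

(* [rot i] and [rot (- i)] are multiplication by the unitaries
   [(1 - b) + i a] and [(1 - b) - i a]. *)
Let rot (c : R[i]) (x : A) := (x - b ** x) + c *: (a ** x).

Let nrm_rot (c : R[i]) x : (c^*)%C = - c -> c * c = -1 -> nrm (rot c x) = nrm x.
Proof.
move=> cc c1; apply: nrm_rotation => //; last exact: nrm_ge0.
  rewrite cstarB !cstarM asa bsa cmulBl cmulBr -!cmulA.
  by rewrite [a ** (b ** x)]cmulA ab -cmulA.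
rewrite -nrm_starM; congr nrm.
rewrite cstarB !cstarM asa bsa cmulBl !cmulBr -!cmulA [a ** (a ** x)]cmulA cosE.
rewrite !(cmulBl, cmulDl, cmulBr, cmulDr) -!cmulA; abel.
Qed.

Lemma nrm_sine_le x : nrm (a ** x) <= nrm x.
Proof.
have := nrm_rot x (conji R) (mulii R); have := nrm_rot x (conjNi R).
rewrite mulrNN => /(_ (mulii R)) E1 E2.
have rotB c : (2 : R[i]) *: (c *: (a ** x)) = rot c x - rot (- c) x.
  by rewrite scaler_nat mulr2n /rot scaleNr; abel.
move: (rotB 'i%C) => /(congr1 (@nrm R A)); rewrite !nrmZ nrmn nrmi => E.
have := nrmD (rot 'i%C x) (- rot (- 'i%C) x); rewrite nrmN; lra.
Qed.

(** This is the bound by 1 of the cosine of the double angle. *)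
Lemma nrm_double_angle_le x :
  nrm (x - (a ** (a ** x) + a ** (a ** x))) <= nrm x.
Proof.
have ci := conji R; have cNi := conjNi R; have ii := mulii R.
have NiNi : - 'i%C * - 'i%C = -1 :> R[i] by rewrite mulrNN.
have E c : c * c = -1 -> rot c (rot c x) =
    (x - (a ** (a ** x) + a ** (a ** x))) + c *: (a ** (x - b ** x)) *+ 2.
  move=> cc; rewrite /rot !cmulDr !cmulNr !cmulZr !scalerDr !scalerA cc.
  rewrite scaleN1r.
  have -> : b ** (a ** x) = a ** (b ** x) by rewrite !cmulA ab.
  have -> : b ** (b ** x) = b ** x + b ** x - a ** (a ** x).
    by rewrite !cmulA cosE cmulBl cmulDl; abel.
  rewrite mulr2n ?scalerN ?cmulDr ?cmulNr ?scalerDr ?scalerN; abel.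
have rotD c : c * c = -1 ->
    (2 : R[i]) *: (x - (a ** (a ** x) + a ** (a ** x))) =
    rot c (rot c x) + rot (- c) (rot (- c) x).
  by move=> cc; rewrite !E ?mulrNN // scaler_nat !mulr2n scaleNr; abel.
move: (rotD _ ii) => /(congr1 (@nrm R A)); rewrite !nrmZ nrmn => E2.
have := nrmD (rot 'i%C (rot 'i%C x)) (rot (- 'i%C) (rot (- 'i%C) x)).
rewrite !nrm_rot //; lra.
Qed.

End Cosine.

(** * Homomorphisms are contractive *)

Section StarHom.
Variables (R : realType) (A B : cstarAlgType R) (f : A -> B).
Hypothesis fh : star_hom f.

Lemma hom_D x y : f (x + y) = f x + f y.
Proof. by have [H _] := fh; exact: H. Qed.
Lemma hom_Z (c : R[i]) x : f (c *: x) = c *: f x.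
Proof. by have [_ [H _]] := fh; exact: H. Qed.
Lemma hom_M x y : f (x ** y) = f x ** f y.
Proof. by have [_ [_ [H _]]] := fh; exact: H. Qed.
Lemma hom_star x : f (cstar x) = cstar (f x).
Proof. by have [_ [_ [_ H]]] := fh; exact: H. Qed.
Lemma hom_0 : f 0 = 0.
Proof. by rewrite -(scale0r 0) hom_Z scale0r. Qed.
Lemma hom_N x : f (- x) = - f x.
Proof. by rewrite -scaleN1r hom_Z scaleN1r. Qed.
Lemma hom_B x y : f (x - y) = f x - f y.
Proof. by rewrite hom_D hom_N. Qed.
Lemma hom_sum (I : Type) (r : seq I) (P : pred I) (F : I -> A) :
  f (\sum_(i <- r | P i) F i) = \sum_(i <- r | P i) f (F i).
Proof. exact: (big_morph f hom_D hom_0). Qed.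

(** A cosine of [a] is mapped to a cosine of [f a], which forces
    [|f a| <= 1]. *)
Lemma hom_contractive x : nrm (f x) <= nrm x.
Proof.
have lt1 a : selfadj a -> nrm a < 1 -> nrm (f a) <= 1.
  move=> asa /(exists_cosine asa) [b [bsa ab cosE]].
  have fasa : selfadj (f a) by rewrite /selfadj -hom_star asa.
  have := @nrm_sine_le R B (f a) (f b) fasa _ _ _ (f a).
  have -> : nrm (f a ** f a) = nrm (f a) * nrm (f a).
    by rewrite -{1}fasa nrm_starM expr2.
  move=> H.
  have [->|fa0] := eqVneq (f a) 0; first by rewrite nrm0.
  have : 0 < nrm (f a) by rewrite nrm_gt0.
  move=> fa1; rewrite -(ler_pM2l fa1) mulr1; apply: H.
  - by rewrite /selfadj -hom_star bsa.
  - by rewrite -!hom_M ab.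
  - by rewrite -!hom_M cosE hom_B hom_D.
have le a : selfadj a -> nrm (f a) <= nrm a.
  move=> asa; rewrite leNgt; apply/negP => lt_a.
  pose r := (nrm a + nrm (f a)) / 2.
  have a0 := nrm_ge0 a; have r0 : 0 < r by rewrite /r; lra.
  have rV : nrm ((r^-1)%:C : R[i]) = r^-1.
    by rewrite nrmR ger0_norm ?invr_ge0 ?ltW.
  have := lt1 ((r^-1)%:C *: a).
  rewrite hom_Z !nrmZ rV -[r^-1 * nrm a]mulrC -[r^-1 * nrm (f a)]mulrC.
  rewrite ltr_pdivrMr // ler_pdivrMr // !mul1r => H.
  have : nrm (f a) <= r.
    by apply: H; [rewrite /selfadj cstarZ asa conjc_real | rewrite /r; lra].
  by rewrite /r; lra.
rewrite -(@ler_pXn2r _ 2) ?nnegrE ?nrm_ge0 // -!nrm_starM -hom_star -hom_M.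
exact/le/selfadj_starM.
Qed.

End StarHom.

(** * Sums of squares *)

Section SumOfSquares.
Variables (R : realType) (A : cstarAlgType R).
Implicit Types (x y z g : A).

Let double_angle g x : selfadj g -> nrm g < 1 ->
  nrm (x - (g ** (g ** x) + g ** (g ** x))) <= nrm x.
Proof.
move=> gsa /(exists_cosine gsa) [b [bsa gb cosE]].
exact: (nrm_double_angle_le gsa bsa gb cosE).
Qed.

(* 19/20 is below 1, so that [g] has a cosine, yet 9 (19/20)^2 > 8. *)
Let square_neg_normalised z g : selfadj g -> nrm z = 19 / 20 ->
  cstar z ** z = - (g ** g) -> False.
Proof.
move=> gsa z1 zg.
have g1 : nrm g = 19 / 20.
  apply/eqP; rewrite -(@eqrXn2 _ 2) ?nrm_ge0 //; last by lra.
  by rewrite -nrm_starM gsa -nrmN -zg nrm_starM z1.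
pose K := z ** cstar z.
have Ksa : selfadj K by rewrite /selfadj cstarM cstarK.
have nK : nrm K = (19 / 20) ^+ 2 by rewrite nrm_Mstar z1.
(* [P] is [1 + 2 K] and [N] is [4 (1 - K / 4)]. *)
pose P x := x + (K ** x + K ** x).
pose N x := x + x + (x + x) - K ** x.
pose D x := (9 : R[i]) *: (K ** x).
have DE x : D x = (4 : R[i]) *: P x - N x.
  by rewrite /D /P /N !scaler_nat !mulrSr !mulr0n; abel.
have ND x : nrm (N x) <= 4 * nrm x.
  pose h x := (2^-1 : R[i]) *: (x : A).
  have hh x1 : h x1 + h x1 = x1 by exact: half_add.
  have hww w x1 : h w ** (h w ** x1) + h w ** (h w ** x1) = h (w ** (w ** x1)).
    by rewrite -cmulDr -cmulDl hh /h cmulZl.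
  pose u := z + cstar z; pose v := 'i%C *: (z - cstar z).
  have hsa x1 : selfadj x1 -> selfadj (h x1).
    by move=> s1; rewrite /h /selfadj cstarZ s1 fmorphV rmorph_nat.
  have usa : selfadj u by rewrite /selfadj cstarD cstarK addrC.
  have vsa : selfadj v.
    by rewrite /selfadj cstarZ cstarB cstarK conji scaleNr -scalerN opprB.
  have nu : nrm (h u) < 1.
    by rewrite nrm_half; have := nrmD z (cstar z); rewrite -/u nrm_star z1; lra.
  have nv : nrm (h v) < 1.
    rewrite nrm_half nrmZ nrmi; have := nrmD z (- cstar z).
    by rewrite nrmN nrm_star z1; lra.
  have ng : nrm (h g) < 1 by rewrite nrm_half g1; lra.
  have Du := double_angle x (hsa _ usa) nu.
  have Dv := double_angle x (hsa _ vsa) nv.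
  have Dg := double_angle x (hsa _ gsa) ng.
  have uvg : u ** u + v ** v + (g ** g + g ** g) = K + K.
    have -> : v ** v = - ((z - cstar z) ** (z - cstar z)).
      by rewrite /v cmulZl cmulZr scalerA mulii scaleN1r.
    rewrite /u !(cmulDl, cmulDr, cmulNl, cmulNr) zg -/K; abel.
  rewrite !hww in Du Dv Dg; move: uvg; clearbody u v => uvg.
  have -> : N x = (x - h (u ** (u ** x))) + (x - h (v ** (v ** x))) +
      ((x - h (g ** (g ** x))) + (x - h (g ** (g ** x)))).
    rewrite /N -[K ** x]hh.
    have -> : h (K ** x) + h (K ** x) =
      h (u ** (u ** x)) + h (v ** (v ** x)) +
      (h (g ** (g ** x)) + h (g ** (g ** x))).
      by rewrite /h -!scalerDr -cmulDl -uvg !cmulDl -!cmulA.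
    abel.
  apply: le_trans (nrmD _ _) _; move: Du Dv Dg.
  set x1 := x - _; set x2 := x - _; set x3 := x - _ => Du Dv Dg.
  by have := nrmD x1 x2; have := nrmD x3 x3; lra.
have PD n x : P (iter n D x) = iter n D (P x).
  elim: n => //= n <-; rewrite /P /D !cmulDr !cmulZr.
  by rewrite !scalerDr.
have bound n : forall i, nrm (iter n D (iter i P (z ** cstar z))) <=
    8 ^+ n * (nrm z * nrm z).
  elim: n => [|n IH] i.
    have -> : iter i P (z ** cstar z) =
        z ** iter i (fun x => x - (g ** (g ** x) + g ** (g ** x))) (cstar z).
      elim: i => //= i ->; set y := iter _ _ _.
      have -> : g ** (g ** y) = - (cstar z ** z) ** y.
        by rewrite zg opprK cmulA.
      by rewrite /P /K cmulDr !(cmulNl, cmulNr, cmulDr) -!cmulA; abel.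
    rewrite /= expr0 mul1r; apply: le_trans (nrmM _ _) _.
    rewrite ler_pM2l ?z1 ?divr_gt0 // -z1 -[leRHS]nrm_star.
    elim: i => //= i IHi; apply: le_trans IHi.
    by apply: double_angle => //; rewrite g1; lra.
  rewrite iterS DE PD -iterS; apply: le_trans (nrmD _ _) _.
  rewrite nrmN nrmZ nrmn exprS; have := IH i; have := IH i.+1.
  have := ND (iter n D (iter i P (z ** cstar z))); lra.
have iterD n x : iter n D x = (9 ^+ n : R[i]) *: iter n (cmul K) x.
  elim: n => [|n /= ->]; first by rewrite expr0 scale1r.
  by rewrite /D cmulZr scalerA exprS.
have sqsE j : sqs j K = iter (2 ^ j).-1 (cmul K) K.
  have itM m n : iter m (cmul K) K ** iter n (cmul K) K =
      iter (m + n).+1 (cmul K) K.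
    by elim: m => //= m IH; rewrite -cmulA IH.
  elim: j => // j; rewrite /sqs iterS => ->; rewrite itM expnS.
  have := expn_gt0 2 j; case: (2 ^ j)%N => // n _.
  by rewrite mul2n -addnn addnS.
suff : 9 * (19 / 20) ^+ 2 <= 8 :> R by lra.
apply: (@le_of_growth _ _ _ 2); [by rewrite ler0n | move=> j].
have := bound (2 ^ j).-1 0%N; rewrite /= iterD -sqsE nrmZ.
have [_ ->] := nrm_sqs j Ksa; rewrite nK -natrX nrmn natrX.
have := expn_gt0 2 j; case: (2 ^ j)%N => // n _ /=.
have : 1 <= 2 ^+ j :> R by rewrite exprn_ege1 // ler1n.
rewrite z1 [(9 * _) ^+ _]exprMn !exprS.
set a1 := 9 ^+ n; set a2 := _ ^+ n; set a3 := 8 ^+ n; set a4 := 2 ^+ j => H1 H2.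
have a30 : 0 < a3 by rewrite exprn_gt0.
nra.
Qed.

(** Scale [z] to norm 19/20.  If [z^* z = - g^2], then [1 + 2 z^* z] is a
    contraction, being the cosine of a double angle; hence the powers of
    [1 + 2 K], for [K = z z^*], are bounded on the range of [z].  On the other
    hand [K = (u^2 + v^2) / 2 + g^2] with [u = z + z^*] and [v = i z - i z^*]
    self-adjoint, so [1 - K / 4], a mean of cosines of double angles, is a
    contraction as well.  The binomial expansion of
    [9 K / 4 = (1 + 2 K) - (1 - K / 4)] then bounds [(9 |K| / 4) ^ n] by a
    multiple of [2 ^ n], although [9 |K| / 4 > 2]. *)
Lemma star_eq_opp_square_eq0 z g : selfadj g -> cstar z ** z = - (g ** g) ->
  z = 0.
Proof.
move=> gsa zg; apply/eqP/negPn/negP => z0; have : 0 < nrm z by rewrite nrm_gt0.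
move=> zp; pose r : R := (19 / 20) / nrm z.
have rC : ((r%:C)^*)%C = r%:C :> R[i] by rewrite conjc_real.
apply: (@square_neg_normalised (r%:C *: z) (r%:C *: g)).
- by rewrite /selfadj cstarZ rC gsa.
- rewrite nrmZ nrmR ger0_norm; first by rewrite /r divfK ?gt_eqF.
  by apply: divr_ge0; [lra | exact: ltW].
- by rewrite cstarZ rC !cmulZl !cmulZr zg !scalerN.
Qed.

(** With [z = x y^*] and [g = y y^*] one has [z^* z = - g^2]. *)
Lemma sum_squares_eq0 x y : cstar x ** x + cstar y ** y = 0 ->
  x = 0 /\ y = 0.
Proof.
move=> xy; have E : cstar x ** x = - (cstar y ** y).
  by apply/eqP; rewrite -addr_eq0 xy.
have gsa : selfadj (y ** cstar y) by rewrite /selfadj cstarM cstarK.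
have zg : cstar (x ** cstar y) ** (x ** cstar y) =
    - ((y ** cstar y) ** (y ** cstar y)).
  rewrite cstarM cstarK cmulA -[y ** cstar x ** x]cmulA E.
  by rewrite !(cmulNl, cmulNr) !cmulA.
have z0 := star_eq_opp_square_eq0 gsa zg.
have y0 : y = 0.
  apply/eqP; rewrite -nrm_eq0.
  have : nrm ((y ** cstar y) ** (y ** cstar y)) = 0.
    by rewrite -nrmN -zg z0 cmul0r nrm0.
  have -> : nrm ((y ** cstar y) ** (y ** cstar y)) = (nrm y ^+ 2) ^+ 2.
    by rewrite -{1}gsa nrm_starM nrm_Mstar.
  by move/eqP; rewrite !sqrf_eq0.
split=> //; apply: starM_eq0; rewrite E y0 cmul0r oppr0 //.
Qed.

End SumOfSquares.

(** * Matrix units *)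

Section Projections.
Variables (R : realType) (A : cstarAlgType R).
Implicit Types (p x : A).

Lemma nrm_projection_le1 p : projection p -> nrm p <= 1.
Proof.
move=> [pp ps]; have := nrm_starM p; rewrite ps pp => E.
have := nrm_ge0 p; nra.
Qed.

Lemma nrm_projection p : projection p -> p <> 0 -> nrm p = 1.
Proof.
move=> [pp ps] /eqP; rewrite -nrm_gt0 => p0.
have := nrm_starM p; rewrite ps pp => E; nra.
Qed.

Lemma nrm_compress_le p x : projection p -> nrm (p ** x ** p) <= nrm x.
Proof.
move=> pp; have p1 := nrm_projection_le1 pp; have p0 := nrm_ge0 p.
have := nrmM (p ** x) p; have := nrmM p x; have := nrm_ge0 x.
by have := nrm_ge0 (p ** x); nra.
Qed.

End Projections.

Section MatrixUnits.
Variables (R : realType) (I : finType) (K : eqType) (blk : I -> K).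
Implicit Types (c d : I -> I -> R[i]).

(** Matrices that are block diagonal for the partition of the indices by
    [blk]. *)
Definition compat c := forall i j, blk i != blk j -> c i j = 0.
Definition cmx_mul c d i l := \sum_j c i j * d j l.
Definition cmx_star c i j := ((c j i)^*)%C.

Lemma compat_mul c d : compat c -> compat d -> compat (cmx_mul c d).
Proof.
move=> cc cd i l il; rewrite /cmx_mul big1 // => j _.
have [ij|/cc ->] := eqVneq (blk i) (blk j); last by rewrite mul0r.
by rewrite cd ?mulr0 // -ij.
Qed.

Lemma compat_star c : compat c -> compat (cmx_star c).
Proof. by move=> cc i j ij; rewrite /cmx_star cc ?conjc0 // eq_sym. Qed.

Section Realisation.
Variables (A : cstarAlgType R) (P : pred I) (E : I -> I -> A).
Hypothesis satP : forall i j, blk i = blk j -> P i = P j.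
Hypothesis E_mul : forall i j k l, P i -> P j -> P k -> P l ->
  blk i = blk j -> blk k = blk l ->
  E i j ** E k l = if j == k then E i l else 0.
Hypothesis E_star : forall i j, cstar (E i j) = E j i.

Definition cmx_val c := \sum_(i | P i) \sum_(j | P j) c i j *: E i j.

Lemma cmx_valM c d : compat c -> compat d ->
  cmx_val c ** cmx_val d = cmx_val (cmx_mul c d).
Proof.
move=> cc cd; rewrite /cmx_val cmul_suml; apply: eq_bigr => i Pi.
rewrite cmul_suml.
have E1 j : P j ->
    (c i j *: E i j) ** (\sum_(k | P k) \sum_(l | P l) d k l *: E k l) =
    \sum_(l | P l) (c i j * d j l) *: E i l.
  move=> Pj; rewrite cmul_sumr (bigD1 j) //= [X in _ + X]big1 ?addr0.
    rewrite cmul_sumr; apply: eq_bigr => l Pl.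
    rewrite cmulZl cmulZr scalerA.
    have [ij|/cc ->] := eqVneq (blk i) (blk j); last by rewrite !mul0r !scale0r.
    have [jl|/cd ->] := eqVneq (blk j) (blk l); last by rewrite !mulr0 !scale0r.
    by rewrite E_mul // eqxx.
  move=> k /andP[Pk kj]; rewrite cmul_sumr big1 // => l Pl.
  rewrite cmulZl cmulZr scalerA.
  have [ij|/cc ->] := eqVneq (blk i) (blk j); last by rewrite !mul0r !scale0r.
  have [kl|/cd ->] := eqVneq (blk k) (blk l); last by rewrite !mulr0 !scale0r.
  by rewrite E_mul // eq_sym (negPf kj) scaler0.
rewrite (eq_bigr _ E1) exchange_big; apply: eq_bigr => l Pl.
rewrite -scaler_suml; congr (_ *: _).
rewrite /cmx_mul [RHS](bigID P) /= [X in _ + X]big1 ?addr0 // => j nPj.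
rewrite cc ?mul0r //; apply: contraNneq nPj => ij.
by rewrite -(satP ij).
Qed.

Lemma cmx_val_star c : cstar (cmx_val c) = cmx_val (cmx_star c).
Proof.
rewrite /cmx_val cstar_sum exchange_big; apply: eq_bigr => i _.
by rewrite cstar_sum; apply: eq_bigr => j _; rewrite cstarZ E_star.
Qed.

Lemma unit_projection i : P i -> projection (E i i).
Proof. by move=> Pi; split; rewrite ?E_star // E_mul // eqxx. Qed.

Lemma nrm_unit i j : P i -> P j -> blk i = blk j ->
  nrm (E i j) ^+ 2 = nrm (E j j).
Proof. by move=> Pi Pj ij; rewrite -nrm_starM E_star E_mul // eqxx. Qed.

Lemma nrm_cmx_val_le c C : compat c -> 0 <= C ->
  (forall i j, nrm (c i j) <= C) ->
  nrm (cmx_val c) <= (#|I| * #|I|)%:R * C.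
Proof.
move=> cc C0 cC; apply: le_trans (nrm_sum _ _ _) _.
have E1 i : P i -> nrm (\sum_(j | P j) c i j *: E i j) <= #|I|%:R * C.
  move=> Pi; apply: le_trans (nrm_sum _ _ _) _.
  have E2 j : P j -> nrm (c i j *: E i j) <= C.
    move=> Pj; rewrite nrmZ.
    have [ij|/cc ->] := eqVneq (blk i) (blk j); last by rewrite nrm0 mul0r.
    have Eij : nrm (E i j) <= 1.
      have := nrm_unit Pi Pj ij.
      have := nrm_projection_le1 (unit_projection Pj).
      by have := nrm_ge0 (E i j); nra.
    have := nrm_ge0 (E i j); have := nrm_ge0 (c i j); have := cC i j; nra.
  apply: le_trans (ler_sum _ E2) _.
  rewrite sumr_const -[leLHS]mulr_natl.
  by apply: ler_wpM2r => //; rewrite ler_nat; exact: max_card.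
apply: le_trans (ler_sum _ E1) _.
rewrite sumr_const -[leLHS]mulr_natl natrM -[leRHS]mulrA.
by apply: ler_wpM2r; rewrite ?mulr_ge0 // ler_nat; exact: max_card.
Qed.

Lemma nrm_coef_le c i j : compat c -> P i -> P j -> E j j <> 0 ->
  nrm (c i j) <= nrm (cmx_val c).
Proof.
move=> cc Pi Pj Ej.
have [ij|/cc ->] := eqVneq (blk i) (blk j); last by rewrite nrm0 nrm_ge0.
have n1 : nrm (E i j) = 1.
  have := nrm_unit Pi Pj ij; rewrite (nrm_projection (unit_projection Pj) Ej).
  by have := nrm_ge0 (E i j); nra.
have -> : nrm (c i j) = nrm (E i i ** cmx_val c ** E j j).
  rewrite /cmx_val cmul_sumr cmul_suml (bigD1 i) //= [X in _ + X]big1 ?addr0.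
    rewrite cmul_sumr cmul_suml (bigD1 j) //= [X in _ + X]big1 ?addr0.
      by rewrite cmulZr cmulZl E_mul // eqxx E_mul // eqxx nrmZ n1 mulr1.
    move=> l /andP[Pl lj]; rewrite cmulZr cmulZl.
    have [il|/cc ->] := eqVneq (blk i) (blk l); last by rewrite scale0r.
    by rewrite E_mul // eqxx E_mul // (negPf lj) scaler0.
  move=> k /andP[Pk ki]; rewrite cmul_sumr cmul_suml big1 // => l Pl.
  rewrite cmulZr cmulZl.
  have [kl|/cc ->] := eqVneq (blk k) (blk l); last by rewrite scale0r.
  by rewrite E_mul // eq_sym (negPf ki) cmul0l scaler0.
have := nrm_projection_le1 (unit_projection Pi).
have := nrm_projection_le1 (unit_projection Pj).
have := nrmM (E i i ** cmx_val c) (E j j); have := nrmM (E i i) (cmx_val c).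
have := nrm_ge0 (cmx_val c); have := nrm_ge0 (E j j); have := nrm_ge0 (E i i).
have := nrm_ge0 (E i i ** cmx_val c); nra.
Qed.

(** The coefficients of [(x^* x) ^ (2 ^ j)], for [x] with coefficients [c]. *)
Definition cmx_sqs c j :=
  iter j (fun d => cmx_mul d d) (cmx_mul (cmx_star c) c).

Lemma compat_sqs c j : compat c -> compat (cmx_sqs c j).
Proof.
move=> cc; elim: j => [|j IH]; last exact: compat_mul.
exact: compat_mul (compat_star cc) cc.
Qed.

Lemma nrm_cmx_sqs c j : compat c ->
  nrm (cmx_val (cmx_sqs c j)) = (nrm (cmx_val c) ^+ 2) ^+ (2 ^ j).
Proof.
move=> cc; rewrite -nrm_starM.
have [_ <-] := nrm_sqs j (selfadj_starM (cmx_val c)); congr nrm.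
elim: j => [|j IH].
  by rewrite /= cmx_val_star cmx_valM //; exact: compat_star.
by rewrite /= -cmx_valM ?IH //; exact: compat_sqs.
Qed.

End Realisation.

(** A system [EA] of matrix units and, for each block, a system [EB] of nonzero
    matrix units.  On the span of the units, taking coefficients and summing
    them compares the norms up to the constant [#|I|^2]; as the comparison
    applies to all the powers of [x^* x], the constant disappears. *)
Lemma matrix_units_nrm_le (A B : cstarAlgType R)
    (EA : I -> I -> A) (EB : I -> I -> B) c M :
  (forall i j k l, blk i = blk j -> blk k = blk l ->
    EA i j ** EA k l = if j == k then EA i l else 0) ->
  (forall i j, cstar (EA i j) = EA j i) ->
  (forall i j k l, blk i = blk j -> blk j = blk k -> blk k = blk l ->
    EB i j ** EB k l = if j == k then EB i l else 0) ->
  (forall i j, cstar (EB i j) = EB j i) ->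
  (forall i, EB i i <> 0) ->
  compat c -> 0 <= M ->
  (forall b, nrm (cmx_val [pred i | blk i == b] EB c) <= M) ->
  nrm (cmx_val predT EA c) <= M.
Proof.
move=> EAM EAs EBM EBs EB0 cc M0 cM.
have EAM' i j k l : predT i -> predT j -> predT k -> predT l ->
  blk i = blk j -> blk k = blk l ->
  EA i j ** EA k l = if j == k then EA i l else 0 by move=> _ _ _ _; exact: EAM.
have EBM' b i j k l : blk i == b -> blk j == b -> blk k == b -> blk l == b ->
  blk i = blk j -> blk k = blk l ->
  EB i j ** EB k l = if j == k then EB i l else 0.
  by move=> /eqP ib /eqP jb /eqP kb /eqP lb _ _; apply: EBM; congruence.
have satB b i j : blk i = blk j -> (blk i == b) = (blk j == b) by move=> ->.
rewrite -(@ler_pXn2r _ 2) ?nnegrE ?nrm_ge0 //.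
apply: (@le_of_growth _ _ _ (#|I| * #|I|)%:R); first by rewrite exprn_ge0.
move=> j; rewrite -(nrm_cmx_sqs (P := predT)) //.
apply: le_trans (nrm_cmx_val_le (C := (M ^+ 2) ^+ (2 ^ j)) EAM' EAs _ _ _) _.
- exact: compat_sqs.
- by rewrite !exprn_ge0.
- move=> i l.
  have [il|/(compat_sqs j cc) ->] := eqVneq (blk i) (blk l); last first.
    by rewrite nrm0 !exprn_ge0.
  have := nrm_coef_le (P := [pred i | blk i == blk l]) (EBM' (blk l)) EBs
    (i := i) (j := l) (compat_sqs j cc).
  rewrite /= il eqxx => /(_ isT isT (EB0 l)) /le_trans; apply.
  rewrite (nrm_cmx_sqs (satB (blk l)) (EBM' (blk l)) EBs) //.
  apply: lerXn2r; rewrite ?nnegrE ?exprn_ge0 ?nrm_ge0 //.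
  by apply: lerXn2r; rewrite ?nnegrE ?nrm_ge0 ?cM.
have : 1 <= 2 ^+ j :> R by rewrite exprn_ege1 // ler1n.
have : 0 <= (M ^+ 2) ^+ (2 ^ j) by rewrite !exprn_ge0.
have : 0 <= (#|I| * #|I|)%:R :> R by rewrite ler0n.
set a1 := _%:R; set a2 := (M ^+ 2) ^+ _; set a3 := 2 ^+ j => a10 a20 a31.
by apply: ler_wpM2r => //; rewrite ler_peMr.
Qed.

End MatrixUnits.

(** * Relations in a Toeplitz-Cuntz-Krieger family *)

Section ToeplitzRelations.
Variables (R : realType) (E : digraph) (A : cstarAlgType R).
Variables (p : vert E -> A) (s : edge E -> A).
Hypothesis ps_TCK : TCK_family p s.

Lemma vert_idem v : p v ** p v = p v.
Proof. by have [[H _] _ _] := ps_TCK; have [] := H v. Qed.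

Lemma vert_star v : cstar (p v) = p v.
Proof. by have [[H _] _ _] := ps_TCK; have [] := H v. Qed.

Lemma vert_orth v w : v <> w -> p v ** p w = 0.
Proof. by have [[_ H] _ _] := ps_TCK; exact: H. Qed.

Lemma edge_starM e : cstar (s e) ** s e = p (src e).
Proof. by have [_ H _] := ps_TCK. Qed.

Lemma edge_src e : s e ** p (src e) = s e.
Proof.
apply/eqP; rewrite eq_sym -subr_eq0; apply/eqP/starM_eq0.
rewrite cstarB cstarM vert_star cmulBl !cmulBr -!cmulA edge_starM.
by rewrite [cstar (s e) ** _]cmulA edge_starM !vert_idem; abel.
Qed.

(** If [p - s s^* = a^* a] is compressed by [1 - p], the first term vanishes and
    what is left is a vanishing sum of two squares. *)
Lemma edge_rng e : p (rng e) ** s e = s e.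
Proof.
have [_ _ T3] := ps_TCK; set q := p (rng e); set x := s e.
have [|a] := T3 (rng e) [set e] (finite_set1 e); first by move=> f ->.
rewrite fsbig_set1 -/q -/x => Ea.
pose l (y : A) := y - q ** y; pose r (y : A) := y - y ** q.
have H : cstar (cstar x - cstar x ** q) ** (cstar x - cstar x ** q) +
    cstar (a - a ** q) ** (a - a ** q) = 0.
  have qq : q ** q = q by exact: vert_idem.
  have qs : cstar q = q by exact: vert_star.
  have -> : cstar (a - a ** q) ** (a - a ** q) = r (l (cstar a ** a)).
    rewrite /r /l cstarB cstarM qs !(cmulBl, cmulBr) -!cmulA.
    by rewrite ?(cmulNl, cmulNr, cmulDl, cmulDr) -?cmulA; abel.
  rewrite -Ea /r /l cstarB cstarM qs cstarK !(cmulBl, cmulBr) -!cmulA !qq.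
  rewrite ?(cmulNl, cmulNr, cmulDl, cmulDr) -?cmulA ?qq.
  by abel.
have [H1 _] := sum_squares_eq0 H.
have := congr1 (@cstar R A) H1.
rewrite cstarB cstarM vert_star cstarK cstar0 => /eqP.
by rewrite subr_eq0 => /eqP <-.
Qed.

(** For edges with the same range, compress [p - s_e s_e^* - s_f s_f^* = a^* a]
    by [s_f]: the terms of [p] and of [s_f s_f^*] cancel, and what is left is a
    vanishing sum of two squares. *)
Lemma edge_orth e f : e <> f -> cstar (s e) ** s f = 0.
Proof.
move=> ef; have [rr|/eqP rr] := eqVneq (rng e) (rng f); last first.
  rewrite -(edge_rng e) -(edge_rng f) cstarM vert_star -!cmulA.
  by rewrite [p _ ** (p _ ** _)]cmulA vert_orth // cmul0l cmul0r.
have [_ _ T3] := ps_TCK.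
have fG : finite_set [set e; f] by exact: finite_set2.
have [|a] := T3 (rng f) [set e; f] fG; first by move=> g [] ->.
rewrite (fsbigD1 e) //=; last by left.
have -> : [set e; f] `\ e = [set f].
  apply/seteqP; split=> g /=; first by case=> [[->|->]].
  by move=> ->; split; [right | move=> fe; apply: ef].
rewrite fsbig_set1 => Ea.
have : cstar (cstar (s e) ** s f) ** (cstar (s e) ** s f) +
    cstar (a ** s f) ** (a ** s f) = 0.
  rewrite !cstarM cstarK -!cmulA [cstar a ** _]cmulA -Ea.
  rewrite !(cmulBl, cmulBr, cmulDl, cmulDr, cmulNl, cmulNr) edge_rng -!cmulA.
  rewrite edge_starM edge_src.
  by rewrite edge_starM ?vert_idem; abel.
by case/sum_squares_eq0.
Qed.

End ToeplitzRelations.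

(** * Paths *)

Section Paths.
Variable E : digraph.
Implicit Types (v w : vert E) (mu nu : seq (edge E)).

Fixpoint vpath v mu : bool :=
  if mu is e :: mu' then (rng e == v) && vpath (src e) mu' else true.

Definition pend v mu := last v [seq src e | e <- mu].

Lemma vpath_cat v mu nu :
  vpath v (mu ++ nu) = vpath v mu && vpath (pend v mu) nu.
Proof. by elim: mu v => //= e mu IH v; rewrite IH andbA. Qed.

Lemma pend_cat v mu nu : pend v (mu ++ nu) = pend (pend v mu) nu.
Proof. by rewrite /pend map_cat last_cat. Qed.

Section PathElements.
Variables (R : realType) (A : cstarAlgType R).
Variables (p : vert E -> A) (s : edge E -> A).

Fixpoint pelt v mu : A :=
  if mu is e :: mu' then s e ** pelt (src e) mu' else p v.

Hypothesis ps_TCK : TCK_family p s.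

Lemma pelt_rng v mu : vpath v mu -> p v ** pelt v mu = pelt v mu.
Proof.
case: mu => [_|e mu /= /andP[/eqP <- _]]; first exact: (vert_idem ps_TCK).
by rewrite cmulA (edge_rng ps_TCK).
Qed.

Lemma pelt_src v mu : pelt v mu ** p (pend v mu) = pelt v mu.
Proof.
elim: mu v => [|e mu IH] v /=; first exact: (vert_idem ps_TCK).
by rewrite -cmulA IH.
Qed.

Lemma pelt_cat v mu nu : vpath (pend v mu) nu ->
  pelt v (mu ++ nu) = pelt v mu ** pelt (pend v mu) nu.
Proof.
elim: mu v => [|e mu IH] v /= Hn; first by rewrite pelt_rng.
by rewrite IH // cmulA.
Qed.

Lemma pelt_starM_cat v mu nu : vpath v mu -> vpath (pend v mu) nu ->
  cstar (pelt v mu) ** pelt v (mu ++ nu) = pelt (pend v mu) nu.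
Proof.
elim: mu v => [|e mu IH] v /=.
  by move=> _ Hn; rewrite (vert_star ps_TCK) pelt_rng.
move=> /andP[_ Hm] Hn; rewrite cstarM -cmulA [cstar (s e) ** _]cmulA.
by rewrite (edge_starM ps_TCK) pelt_rng ?IH // vpath_cat Hm.
Qed.

Lemma pelt_starM v mu : vpath v mu ->
  cstar (pelt v mu) ** pelt v mu = p (pend v mu).
Proof. by move=> Hm; rewrite -{2}[mu]cats0 pelt_starM_cat. Qed.

Lemma pelt_orth v mu w nu : vpath v mu -> vpath w nu ->
  (size mu <= size nu)%N -> ~~ ((v == w) && prefix mu nu) ->
  cstar (pelt v mu) ** pelt w nu = 0.
Proof.
elim: mu v w nu => [|e mu IH] v w nu /=.
  move=> _ Hn _; rewrite prefix0s andbT => /eqP vw.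
  by rewrite (vert_star ps_TCK) -pelt_rng // cmulA (vert_orth ps_TCK) ?cmul0l.
case: nu => //= f nu /andP[/eqP rv Hm] /andP[/eqP rw Hn] mn.
have [ef|/eqP ef] := eqVneq e f; last first.
  move=> _; rewrite cstarM -cmulA [cstar (s e) ** _]cmulA.
  by rewrite (edge_orth ps_TCK) // cmul0l cmul0r.
move: Hm Hn; rewrite -rv -rw ef eqxx /= => Hm Hn nmn.
rewrite cstarM -cmulA [cstar (s f) ** _]cmulA (edge_starM ps_TCK).
by rewrite pelt_rng // IH // eqxx.
Qed.

End PathElements.
End Paths.

(** * Aperiodic paths *)

Section AperiodicPaths.
Variable E : digraph.
Implicit Types (v w : vert E) (mu nu : seq (edge E)).
Hypothesis entrances : forall mu, is_cycle mu -> ~ no_entrance mu.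

Let closed_at w mu := vpath w mu && (pend w mu == w).

Lemma cycle_path_vpath (e f : edge E) mu :
  path (fun e f : edge E => src e == rng f) e (rcons mu f) =
  vpath (src e) mu && (pend (src e) mu == rng f).
Proof.
elim: mu e => [|g mu IH] e /=; first by rewrite andbT.
by rewrite IH andbA [rng g == _]eq_sym.
Qed.

Lemma minimal_closed_is_cycle w mu : closed_at w mu -> mu != [::] ->
  (forall nu, closed_at w nu -> nu != [::] -> (size mu <= size nu)%N) ->
  is_cycle mu.
Proof.
move=> /andP[wmu /eqP emu] mu0 mumin; split=> //.
  case: mu mu0 wmu emu {mumin} => //= e mu _ /andP[/eqP re wmu] emu.
  by rewrite cycle_path_vpath wmu re -emu eqxx.
apply: contraT => /(uniqPn w) [i [j [ij jn eij]]].
rewrite size_map in jn.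
have pend_take k : (k < size mu)%N ->
    pend w (take k.+1 mu) = nth w [seq src e | e <- mu] k.
  move=> kn; rewrite /pend map_take (take_nth w) ?size_map //.
  by rewrite last_rcons.
pose nu := take i.+1 mu ++ drop j.+1 mu.
have in' := ltn_trans ij jn.
have cnu : closed_at w nu.
  rewrite /closed_at /nu vpath_cat pend_cat (pend_take i) // eij -pend_take //.
  move: (wmu); rewrite -{1}(cat_take_drop j.+1 mu) vpath_cat => /andP[_ ->].
  rewrite -pend_cat cat_take_drop emu eqxx !andbT.
  by move: (wmu); rewrite -{1}(cat_take_drop i.+1 mu) vpath_cat => /andP[].
have nu0 : nu != [::] by rewrite -size_eq0 size_cat size_takel.
have := mumin _ cnu nu0.
rewrite size_cat size_drop size_takel //; lia.
Qed.

Lemma prefix_cat_size (T : eqType) (a b c d : seq T) : (size a <= size c)%N ->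
  prefix (a ++ b) (c ++ d) -> exists2 c', c = a ++ c' & prefix b (c' ++ d).
Proof.
move=> ac pab; have /prefixP[r Er] := pab.
have Ea : a = take (size a) c.
  have := congr1 (take (size a)) Er.
  by rewrite takel_cat // -catA take_size_cat // => ->.
exists (drop (size a) c); first by rewrite {1}Ea cat_take_drop.
move: pab; rewrite -{1}(cat_take_drop (size a) c) -Ea -catA.
by rewrite prefix_catr // eqxx.
Qed.

(** If [w] lies on a closed path, take a shortest one, a cycle [g = x f y] with
    an entrance [e] at the range of [f], and follow [g^n x e]: a closed path of
    length at most [n] shifting it onto itself would be a power of [g], and
    then [e = f]. *)
Lemma exists_aperiodic_path n w : exists lam, vpath w lam /\
  forall mu, vpath w mu -> pend w mu = w -> (0 < size mu <= n)%N ->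
    ~~ prefix lam (mu ++ lam).
Proof.
have [[g0 cg0 g00]|nog] := pselect (exists2 g, closed_at w g & g != [::]);
  last first.
  exists [::]; split=> // mu wmu emu /andP[mu0 _]; case: nog.
  by exists mu; [rewrite /closed_at wmu emu eqxx | rewrite -size_eq0 -lt0n].
pose P k := `[< exists2 g, closed_at w g & g != [::] /\ size g = k >].
have exP : exists k, P k by exists (size g0); apply/asboolP; exists g0.
case: (ex_minnP exP) => k /asboolP[g cg [gn0 gk]] gmin.
have {gmin} gmin nu : closed_at w nu -> nu != [::] -> (size g <= size nu)%N.
  by move=> cnu nu0; rewrite gk; apply: gmin; apply/asboolP; exists nu.
have := entrances (minimal_closed_is_cycle cg gn0 gmin).
move=> /existsNP[e /existsNP[f]] /not_implyP[fg /not_implyP[ref ef]].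
move/andP: cg => [wg /eqP eg].
case/splitPr: fg wg eg gmin gn0 => x y wg eg gmin gn0 {gk g}.
set g := x ++ f :: y in wg eg gmin gn0.
have gE : g = x ++ f :: y by [].
clearbody g.
pose pw m := iter m (cat g) (x ++ [:: e]).
have wpw m : vpath w (pw m).
  elim: m => [|m IH]; last by rewrite /pw iterS vpath_cat wg eg.
  by move: wg; rewrite gE !vpath_cat /= ref => /and3P[-> ->].
exists (pw n); split=> // mu wmu emu /andP[mu0 mun]; apply/negP.
have : (n <= n)%N by [].
elim: {1 2 4}n mu wmu emu mu0 mun => [|m IH] mu wmu emu mu0 mun mn.
  by case: mu mu0 mun {wmu emu}.
have gmu : (size g <= size mu)%N.
  by apply: gmin; rewrite ?/closed_at ?wmu ?emu ?eqxx // -size_eq0 -lt0n.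
rewrite /pw iterS -/(pw m) => /(prefix_cat_size gmu)[mu' Emu].
have gpos : (0 < size g)%N by rewrite lt0n size_eq0.
move: wmu emu mun; rewrite Emu vpath_cat pend_cat wg eg size_cat /=.
move=> wmu emu mun.
case: mu' {Emu} wmu emu mun => [|e1 mu'] wmu emu mun; last first.
  apply: IH => //; last exact: ltnW.
  by rewrite -ltnS (leq_trans _ mun) // -[X in (X < _)%N]add0n ltn_add2r.
rewrite /= -/(pw n).
have -> : pw n = iter m (cat g) (pw (n - m)%N).
  by rewrite /pw -iterD subnKC // ltnW.
have : (0 < n - m)%N by rewrite subn_gt0.
case: (n - m)%N => // k' _; rewrite /pw.
elim: m {IH mn mun} => [|m IH]; last by rewrite !iterS prefix_catr // eqxx.
rewrite /= gE -!catA prefix_catr // eqxx /= => /andP[/eqP fe _].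
exact: ef.
Qed.

End AperiodicPaths.

(** * The span of the elements s_mu s_nu^* *)

Section LinearSpan.
Variables (R : realType) (A : cstarAlgType R).
Implicit Types (P Q : A -> Prop) (a b w : A) (c : R[i]).

Inductive lspan P : A -> Prop :=
| Lspan0 : lspan P 0
| LspanZD c w a : P w -> lspan P a -> lspan P (c *: w + a).

Lemma lspan_in P w : P w -> lspan P w.
Proof.
move=> Pw; rewrite -[w]addr0 -[w]scale1r.
by apply: LspanZD => //; exact: Lspan0.
Qed.

Lemma lspanD P a b : lspan P a -> lspan P b -> lspan P (a + b).
Proof.
elim=> [|c w a' Pw _ IH] Pb; first by rewrite add0r.
by rewrite -addrA; constructor=> //; exact: IH.
Qed.

Lemma lspanZ P c a : lspan P a -> lspan P (c *: a).
Proof.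
elim=> [|d w a' Pw _ IH]; first by rewrite scaler0; constructor.
by rewrite scalerDr scalerA; constructor.
Qed.

Lemma lspan_sum P (I : eqType) (r : seq I) (F : I -> A) :
  (forall i, i \in r -> lspan P (F i)) -> lspan P (\sum_(i <- r) F i).
Proof.
move=> PF; rewrite big_seq; elim/big_ind: _ => //; first exact: Lspan0.
exact: lspanD.
Qed.

Lemma lspan_bind P Q a : (forall w, P w -> lspan Q w) -> lspan P a -> lspan Q a.
Proof.
move=> PQ; elim=> [|c w a' Pw _ IH]; first exact: Lspan0.
by apply: lspanD IH; apply: lspanZ; exact: PQ.
Qed.

Lemma lspan_star P Q a : (forall w, P w -> lspan Q (cstar w)) ->
  lspan P a -> lspan Q (cstar a).
Proof.
move=> PQ; elim=> [|c w a' Pw _ IH]; first by rewrite cstar0; exact: Lspan0.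
by rewrite cstarD cstarZ; apply: lspanD IH; apply: lspanZ; exact: PQ.
Qed.

Lemma lspan_mul P1 P2 Q a b :
  (forall w1 w2, P1 w1 -> P2 w2 -> lspan Q (w1 ** w2)) ->
  lspan P1 a -> lspan P2 b -> lspan Q (a ** b).
Proof.
move=> PQ P1a P2b; elim: P1a => [|c w a' Pw _ IH].
  by rewrite cmul0l; exact: Lspan0.
rewrite cmulDl cmulZl; apply: lspanD IH; apply: lspanZ.
elim: P2b => [|d w' b' Pw' _ IH]; first by rewrite cmul0r; exact: Lspan0.
by rewrite cmulDr cmulZr; apply: lspanD IH; apply: lspanZ; exact: PQ.
Qed.

End LinearSpan.

Section Monomials.
Variables (R : realType) (E : digraph) (A : cstarAlgType R).
Variables (p : vert E -> A) (s : edge E -> A).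

Notation gpath := (vert E * seq (edge E))%type.
Implicit Types x y z : gpath.

Definition valid x := vpath x.1 x.2.
Definition plen x := size x.2.
Definition psrc x := pend x.1 x.2.
Definition pe x : A := pelt p s x.1 x.2.

Definition mono n (k : int) (w : A) := exists x y,
  [/\ [/\ valid x, valid y & psrc x = psrc y], (plen x <= n)%N, (plen y <= n)%N,
      (plen x)%:Z - (plen y)%:Z = k & w = pe x ** cstar (pe y)].

Definition graded n k := lspan (mono n k).
Definition offdiag n := lspan (fun w => exists2 k, k != 0 & mono n k w).
Definition level n := lspan (fun w => exists k, mono n k w).

(** The paths that the Cuntz-Krieger relation cannot lengthen inside level [n]:
    none of them extends another. *)
Definition stop n x :=
  plen x = n \/ (plen x <= n)%N /\ forall e : edge E, rng e <> psrc x.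

Definition core n (w : A) := exists x y,
  [/\ [/\ valid x, valid y & psrc x = psrc y], stop n x, stop n y,
      plen x = plen y & w = pe x ** cstar (pe y)].

Hypothesis ps_TCK : TCK_family p s.

Lemma mono_star n k w : mono n k w -> mono n (- k) (cstar w).
Proof.
move=> [x [y [[vx vy xy] xn yn <- ->]]]; exists y, x; split=> //.
  by rewrite opprB.
by rewrite cstarM cstarK.
Qed.

Lemma mono_mul n m k l w w' : mono n k w -> mono m l w' ->
  w ** w' = 0 \/ mono (n + m) (k + l) (w ** w').
Proof.
move=> [[x1 x2] [[y1 y2] [[vx vy xy] xn yn <- ->]]].
move=> [[x1' x2'] [[y1' y2'] [[vx' vy' xy'] xn' yn' <- ->]]].
rewrite /valid /plen /psrc /pe /= in vx vy xy xn yn vx' vy' xy' xn' yn' *.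
rewrite -cmulA [cstar (pelt _ _ y1 y2) ** _]cmulA.
have [le|/ltnW le] := leqP (size y2) (size x2').
  have [/andP[/eqP y1x /prefixP[z Ez]]|npre] :=
    boolP ((y1 == x1') && prefix y2 x2'); last first.
    by left; rewrite pelt_orth // cmul0l cmul0r.
  subst x1' x2'; right; rewrite vpath_cat vy /= in vx'.
  rewrite pend_cat -xy in xy'; rewrite -xy in vx'.
  exists (x1, x2 ++ z), (y1', y2').
  rewrite /valid /plen /psrc /pe /= !vpath_cat vx vx' pend_cat xy' !size_cat.
  rewrite size_cat in xn'.
  split=> //; try lia.
  by rewrite pelt_starM_cat // -?xy // cmulA -pelt_cat.
have [/andP[/eqP y1x /prefixP[z Ez]]|npre] :=
  boolP ((x1' == y1) && prefix x2' y2); last first.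
  left; rewrite -[cstar _ ** pelt _ _ _ _]cstarK cstarM cstarK.
  by rewrite (pelt_orth ps_TCK) // cstar0 cmul0l cmul0r.
subst x1' y2; right; rewrite vpath_cat vx' /= in vy.
rewrite pend_cat xy' in xy; rewrite xy' in vy.
exists (x1, x2), (y1', y2' ++ z).
rewrite /valid /plen /psrc /pe /= !vpath_cat vx vy' vy pend_cat xy !size_cat.
rewrite size_cat in yn.
split=> //; try lia.
rewrite -[cstar _ ** pelt _ _ _ _]cstarK [cstar (cstar _ ** _)]cstarM cstarK.
by rewrite (pelt_starM_cat ps_TCK) ?xy' // -cstarM -pelt_cat.
Qed.

Lemma graded_star n k a : graded n k a -> graded n (- k) (cstar a).
Proof. by apply: lspan_star => w /mono_star /lspan_in. Qed.

Lemma graded_mul n m k l a b : graded n k a -> graded m l b ->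
  graded (n + m) (k + l) (a ** b).
Proof.
apply: lspan_mul => w1 w2 m1 m2; have [->|/lspan_in] := mono_mul m1 m2 => //.
exact: Lspan0.
Qed.

Lemma level_star n a : level n a -> level n (cstar a).
Proof.
by apply: lspan_star => w [k /mono_star m]; apply: lspan_in; exists (- k).
Qed.

Lemma level_mul n m a b : level n a -> level m b -> level (n + m) (a ** b).
Proof.
apply: lspan_mul => w1 w2 [k m1] [l m2].
have [->|m12] := mono_mul m1 m2; first exact: Lspan0.
by apply: lspan_in; exists (k + l).
Qed.

Lemma level_le n m a : (n <= m)%N -> level n a -> level m a.
Proof.
move=> nm; apply: lspan_bind => w [k [x [y [xy xn yn xyk ->]]]].
apply: lspan_in; exists k, x, y.
by split=> //; [exact: leq_trans xn nm | exact: leq_trans yn nm].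
Qed.

(** Degrees range from [- n] to [n]; the component of degree [k] has number
    [k + n]. *)
Lemma level_grading n a : level n a -> exists2 b : nat -> A,
  forall i, graded n (i%:Z - n%:Z) (b i) & a = \sum_(i < (2 * n).+1) b i.
Proof.
elim=> [|c w a' [k mw] _ [b bg ->]].
  by exists (fun=> 0); [move=> i; exact: Lspan0 | rewrite big1].
have [i in2 ik] : exists2 i, (i < (2 * n).+1)%N & i%:Z - n%:Z = k.
  have [x [y [_ xn yn <- _]]] := mw.
  by exists (n + plen x - plen y)%N; lia.
exists (fun j => (if j == i then c *: w else 0) + b j).
  move=> j; apply: lspanD (bg j); case: eqP => [->|_]; last exact: Lspan0.
  by rewrite ik; apply/lspanZ/lspan_in.
rewrite big_split /=; congr (_ + _).
rewrite (bigD1 (Ordinal in2)) //= eqxx big1 ?addr0 // => j.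
by rewrite -val_eqE /= => /negPf ->.
Qed.

Section Expansion.
Hypothesis rowE : row_finite E.
Hypothesis ps_CK : CK_family p s.

(** The Cuntz-Krieger relation inserted between [s_mu] and [s_nu^*] lengthens
    both paths by one edge. *)
Lemma core_expand n w : mono n 0 w -> lspan (core n) w.
Proof.
move=> [x [y [[vx vy xy] xn yn xy0 ->]]].
have {xy0} sz : plen x = plen y by lia.
move: {2}(n - plen x)%N (erefl (n - plen x)%N) => d.
elim: d x y vx vy xy xn {yn} sz => [|d IH] x y vx vy xy xn sz nd.
  apply: lspan_in; exists x, y; split=> //; left; lia.
have [src_x|nsrc] := pselect (forall e : edge E, rng e <> psrc x).
  apply: lspan_in; exists x, y; split=> //; right; split=> //.
    by rewrite -sz.
  by rewrite -xy.
have ne : [set e : edge E | rng e = psrc x] !=set0.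
  by apply: contrapT => H; apply: nsrc => e re; apply: H; exists e.
have -> : pe x ** cstar (pe y) = pe x ** p (psrc x) ** cstar (pe y).
  by rewrite /pe pelt_src.
rewrite (ps_CK.2 _ ne (rowE _)) fsbig_finite; last exact: rowE.
rewrite cmul_sumr cmul_suml; apply: lspan_sum => e.
rewrite in_fset_set; last exact: rowE.
rewrite inE /= => re.
have -> : pe x ** (s e ** cstar (s e)) ** cstar (pe y) =
    pe (x.1, x.2 ++ [:: e]) ** cstar (pe (y.1, y.2 ++ [:: e])).
  rewrite /pe /= !(pelt_cat ps_TCK) /= ?andbT; last 2 first.
  - by apply/eqP; rewrite re -/(psrc y) -xy.
  - by apply/eqP.
  by rewrite (edge_src ps_TCK) cstarM !cmulA.
apply: IH; rewrite /valid /plen /psrc /= ?vpath_cat ?pend_cat ?size_cat /=.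
- by rewrite andbT -/(valid x) vx; apply/eqP.
- by rewrite andbT -/(valid y) vy; apply/eqP; rewrite re xy.
- by [].
- by move: nd; rewrite /plen; lia.
- by move: sz; rewrite /plen; lia.
- by move: nd; rewrite /plen; lia.
Qed.

Lemma graded0_core n a : graded n 0 a -> lspan (core n) a.
Proof. by apply: lspan_bind => w; exact: core_expand. Qed.

End Expansion.

Lemma core_matrix n a : lspan (core n) a ->
  exists (I : finType) (ix : I -> gpath) (c : I -> I -> R[i]),
    [/\ injective ix, forall i, valid (ix i) /\ stop n (ix i),
        compat (fun i => (plen (ix i), psrc (ix i))) c
      & a = cmx_val predT (fun i j => pe (ix i) ** cstar (pe (ix j))) c].
Proof.
move=> ca.
have [L HL ->] : exists2 L : seq (R[i] * (gpath * gpath)),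
    forall t, t \in L ->
    [/\ [/\ valid t.2.1, valid t.2.2 & psrc t.2.1 = psrc t.2.2],
      stop n t.2.1, stop n t.2.2 & plen t.2.1 = plen t.2.2] &
    a = \sum_(t <- L) t.1 *: (pe t.2.1 ** cstar (pe t.2.2)).
  elim: ca => [|c w a' [x [y [xy sx sy szxy ->]]] _ [L HL ->]].
    by exists [::] => //; rewrite big_nil.
  exists ((c, (x, y)) :: L); last by rewrite big_cons.
  by move=> t; rewrite inE => /orP[/eqP -> //|/HL].
pose T := [seq t.2.1 | t <- L] ++ [seq t.2.2 | t <- L].
exists (seq_sub T), val, (fun i j =>
  \sum_(t <- L | (t.2.1 == val i) && (t.2.2 == val j)) t.1).
split.
- exact: val_inj.
- move=> [x xT] /=; move: xT; rewrite mem_cat.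
  by case/orP=> /mapP[t /HL [[? ? ?] ? ? ?] ->].
- move=> i j; rewrite big_seq_cond => ij; apply: big1 => t.
  move=> /andP[/HL[[_ _ e1] _ _ e2] /andP[/eqP ti /eqP tj]].
  by move: ij; rewrite -ti -tj e1 e2 eqxx.
pose EA (x y : gpath) := pe x ** cstar (pe y).
transitivity (\sum_(t <- L) \sum_(i : seq_sub T) \sum_(j : seq_sub T)
    if (t.2.1 == val i) && (t.2.2 == val j)
    then t.1 *: EA (val i) (val j) else 0).
  rewrite big_seq [RHS]big_seq; apply: eq_bigr => t tL.
  have t1T : t.2.1 \in T.
    by rewrite mem_cat; apply/orP; left; apply/mapP; exists t.
  have t2T : t.2.2 \in T.
    by rewrite mem_cat; apply/orP; right; apply/mapP; exists t.
  rewrite (bigD1 (SeqSub t1T)) //= [X in _ + X]big1 ?addr0; last first.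
    move=> i it; rewrite big1 // => j _; case: andP => // -[/eqP ti _].
    by move: it; rewrite -val_eqE /= -ti eqxx.
  rewrite (bigD1 (SeqSub t2T)) //= [X in _ + X]big1 ?addr0 ?eqxx //.
  move=> j jt; case: andP => // -[_ /eqP tj].
  by move: jt; rewrite -val_eqE /= -tj eqxx.
rewrite exchange_big; apply: eq_bigr => i _.
rewrite exchange_big; apply: eq_bigr => j _.
by rewrite scaler_suml -big_mkcond.
Qed.

End Monomials.

(** * Compression to the diagonal *)

Section Compression.
Variables (R : realType) (E : digraph) (B : cstarAlgType R).
Variables (q : vert E -> B) (t : edge E -> B).
Hypothesis qt_TCK : TCK_family q t.

Notation gpath := (vert E * seq (edge E))%type.
Implicit Types x y k l : gpath.

Lemma stop_prefix n x k : valid x -> valid k -> stop n x -> (plen k <= n)%N ->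
  cstar (pe q t x) ** pe q t k = 0 \/ exists z, x = (k.1, k.2 ++ z).
Proof.
case: x => [x1 x2]; case: k => [k1 k2].
rewrite /valid /stop /plen /psrc /pe /= => vx vk sx kn.
have [le|lt] := leqP (size k2) (size x2).
  have [/andP[/eqP -> /prefixP[z ->]]|npre] :=
    boolP ((k1 == x1) && prefix k2 x2).
    by right; exists z.
  left; rewrite -[cstar _ ** pelt _ _ _ _]cstarK cstarM cstarK.
  by rewrite (pelt_orth qt_TCK) // cstar0.
left; have [/andP[/eqP xk /prefixP[z Ez]]|npre] :=
  boolP ((x1 == k1) && prefix x2 k2).
  case: sx => [xn|[_ nsrc]]; first by lia.
  subst k1 k2; move: vk lt; rewrite vpath_cat vx size_cat.
  by case: z {kn} => [|e z] /=; [lia | move=> /andP[/eqP /nsrc]].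
by rewrite (pelt_orth qt_TCK) // ltnW.
Qed.

Lemma stop_starM n x k : valid x -> valid k -> stop n x -> stop n k ->
  cstar (pe q t x) ** pe q t k = if x == k then q (psrc x) else 0.
Proof.
move=> vx vk sx sk.
have kn : (plen k <= n)%N by case: sk => [->|[]].
have xn : (plen x <= n)%N by case: sx => [->|[]].
have [<-|xk] := eqVneq x k; first exact: (pelt_starM qt_TCK).
have [//|[z Ez]] := stop_prefix vx vk sx kn.
have [H|[z' Ez']] := stop_prefix vk vx sk xn.
  by rewrite -[LHS]cstarK cstarM cstarK H cstar0.
have e1 := congr1 (fun x => size x.2) Ez.
have e2 := congr1 (fun x => size x.2) Ez'.
rewrite /= !size_cat in e1 e2.
have z0 : size z = 0%N by lia.
by move: xk; rewrite Ez (size0nil z0) cats0 -surjective_pairing eqxx.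
Qed.

Variables (n : nat) (lam : vert E -> seq (edge E)).
Hypothesis lamP : forall w, vpath w (lam w) /\
  forall mu, vpath w mu -> pend w mu = w -> (0 < size mu <= n)%N ->
    ~~ prefix (lam w) (mu ++ lam w).

Definition ext x : B := pelt q t x.1 (x.2 ++ lam (psrc x)).

Lemma ext_cat x : ext x = pe q t x ** pelt q t (psrc x) (lam (psrc x)).
Proof. by rewrite /ext pelt_cat //; have [] := lamP (psrc x). Qed.

Lemma ext_starM x : valid x ->
  cstar (ext x) ** ext x = q (pend (psrc x) (lam (psrc x))).
Proof.
move=> vx; rewrite /ext (pelt_starM qt_TCK) ?pend_cat // vpath_cat.
by have [-> _] := lamP (psrc x); rewrite andbT.
Qed.

(** If the product were nonzero, the longer of the two paths would be the
    shorter one followed by a closed path that shifts [lam w] onto itself. *)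
Lemma offdiag_closed v w z z' : vpath v z -> vpath v z' ->
  pend v z = w -> pend v z' = w -> size z <> size z' ->
  (size z <= n)%N -> (size z' <= n)%N ->
  cstar (pelt q t v (z ++ lam w)) ** pelt q t v (z' ++ lam w) = 0.
Proof.
have [lw lwP] := lamP w.
wlog lt : z z' / (size z < size z')%N => [wl|] vz vz' zw zw' ss zn zn'.
  have [lt|gt|//] := ltngtP (size z) (size z'); first exact: wl.
  rewrite -[LHS]cstarK cstarM cstarK wl ?cstar0 //; exact: nesym.
apply: (pelt_orth qt_TCK); rewrite ?vpath_cat ?vz ?vz' ?zw ?zw' ?lw //.
  by rewrite !size_cat leq_add2r ltnW.
rewrite eqxx; apply/negP => /(prefix_cat_size (ltnW lt)) [g Eg].
move: vz' zw' lt zn'; rewrite Eg vpath_cat pend_cat zw size_cat.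
move=> /andP[_ vg] eg lt zn'; apply/negP/lwP => //; lia.
Qed.

(** A path of length at most [n] is either an initial segment of [x] or
    orthogonal to it, as [x] cannot be lengthened. *)
Lemma stop_ext x a : valid x -> valid a -> stop n x -> (plen a <= n)%N ->
  cstar (pe q t a) ** ext x = 0 \/ exists z,
    [/\ x = (a.1, a.2 ++ z), vpath (psrc a) z &
        cstar (pe q t a) ** ext x = pelt q t (psrc a) (z ++ lam (psrc x))].
Proof.
move=> vx va sx an; have [H|[z Ex]] := stop_prefix vx va sx an.
  left; rewrite ext_cat cmulA -[cstar _ ** pe q t x]cstarK cstarM cstarK H.
  by rewrite cstar0 cmul0l.
have vz : vpath (psrc a) z by move: vx; rewrite Ex /valid vpath_cat => /andP[].
right; exists z; split=> //.
have zx : pend (psrc a) z = psrc x by rewrite Ex {2}/psrc /= pend_cat.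
rewrite /ext; move: (psrc x) zx => w zx; rewrite Ex /= -catA.
rewrite (pelt_starM_cat qt_TCK) // -/(psrc a) vpath_cat vz zx.
by have [] := lamP w.
Qed.

Lemma ext_offdiag (k : int) w x y : k != 0 -> mono q t n k w ->
  valid x -> valid y -> stop n x -> stop n y ->
  plen x = plen y -> psrc x = psrc y ->
  cstar (ext x) ** w ** ext y = 0.
Proof.
move=> k0 [a [b [[va vb ab] an bn abk ->]]] vx vy sx sy lxy xy.
have -> : cstar (ext x) ** (pe q t a ** cstar (pe q t b)) ** ext y =
    cstar (cstar (pe q t a) ** ext x) ** (cstar (pe q t b) ** ext y).
  by rewrite cstarM cstarK !cmulA.
have [->|[z [Ex vz ->]]] := stop_ext vx va sx an.
  by rewrite cstar0 cmul0l.
have [->|[z' [Ey vz' ->]]] := stop_ext vy vb sy bn; first by rewrite cmul0r.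
have xn : (plen x <= n)%N by case: sx => [->|[]].
have yn : (plen y <= n)%N by case: sy => [->|[]].
rewrite -ab -xy; apply: offdiag_closed; rewrite ?ab //.
- by rewrite -ab.
- by rewrite -ab Ex {2}/psrc /= pend_cat.
- by rewrite xy Ey {2}/psrc /= pend_cat.
- move=> szz; move: k0 lxy abk; rewrite Ex Ey /plen /= !size_cat; lia.
- by move: xn; rewrite Ex /plen /= size_cat; lia.
- by move: yn; rewrite Ey /plen /= size_cat; lia.
Qed.

End Compression.

(** * Homomorphisms are isometric on the span *)

Section DiagonalBound.
Variables (R : realType) (E : digraph) (A B : cstarAlgType R).
Variables (p : vert E -> A) (s : edge E -> A).
Variables (q : vert E -> B) (t : edge E -> B) (f : A -> B).
Hypotheses (rowE : row_finite E)
  (entrances : forall mu : seq (edge E), is_cycle mu -> ~ no_entrance mu).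
Hypotheses (ps_CK : CK_family p s) (qt_TCK : TCK_family q t).
Hypothesis q0 : forall v, q v <> 0.
Hypotheses (fh : star_hom f) (fp : forall v, f (p v) = q v)
  (fs : forall e, f (s e) = t e).

Let ps_TCK : TCK_family p s := ps_CK.1.

Lemma hom_pe x : f (pe p s x) = pe q t x.
Proof.
case: x => v mu; rewrite /pe /=; elim: mu v => [|e mu IH] v /=; first exact: fp.
by rewrite (hom_M fh) fs IH.
Qed.

Lemma hom_mono n k w : mono p s n k w -> mono q t n k (f w).
Proof.
move=> [x [y [? ? ? ? ->]]]; exists x, y; split=> //.
by rewrite (hom_M fh) (hom_star fh) !hom_pe.
Qed.

Lemma pe_matrix_units x y k l n : valid x -> valid y -> valid k -> valid l ->
  stop n y -> stop n k -> psrc x = psrc y ->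
  pe p s x ** cstar (pe p s y) ** (pe p s k ** cstar (pe p s l)) =
  if y == k then pe p s x ** cstar (pe p s l) else 0.
Proof.
move=> vx vy vk vl sy sk xy; rewrite -cmulA [cstar (pe p s y) ** _]cmulA.
rewrite (stop_starM ps_TCK vy vk sy sk); case: eqP => _.
  by rewrite cmulA -xy (pelt_src ps_TCK).
by rewrite cmul0l cmul0r.
Qed.

(** The compression of [f (a0 + a1)] by the projection onto a block of matrix
    units [s_(mu lam) s_(nu lam)^*] kills [f a1] and keeps the coefficients of
    [a0] in that block. *)
Lemma nrm_graded0_le n a0 a1 : graded p s n 0 a0 -> offdiag p s n a1 ->
  nrm a0 <= nrm (f (a0 + a1)).
Proof.
move=> /(graded0_core ps_TCK rowE ps_CK)/core_matrix.
move=> [I [ix [c [ixI ixP cc Ea0]]]] oa1.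
have [lam lamP] := choice (exists_aperiodic_path entrances n).
pose X i := ext q t lam (ix i).
pose EB i j := X i ** cstar (X j).
pose blk i := (plen (ix i), psrc (ix i)).
have XM i j : blk i = blk j -> cstar (X i) ** X j =
    if i == j then q (pend (psrc (ix i)) (lam (psrc (ix i)))) else 0.
  move=> [lij pij]; have [vi si] := ixP i; have [vj sj] := ixP j.
  have [<-|ij] := eqVneq i j; first exact: (ext_starM qt_TCK lamP).
  rewrite /X !(ext_cat qt_TCK lamP) cstarM -!cmulA [cstar (pe _ _ _) ** _]cmulA.
  rewrite (stop_starM qt_TCK vi vj si sj) (inj_eq ixI) (negPf ij).
  by rewrite cmul0l cmul0r.
have Xq i : X i ** q (pend (psrc (ix i)) (lam (psrc (ix i)))) = X i.
  by rewrite /X /ext -pend_cat (pelt_src qt_TCK).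
have EBM i j k l : blk i = blk j -> blk j = blk k -> blk k = blk l ->
    EB i j ** EB k l = if j == k then EB i l else 0.
  move=> ij jk kl; rewrite /EB -cmulA [cstar (X j) ** _]cmulA XM //.
  case: eqP => _; last by rewrite cmul0l cmul0r.
  by move: ij => [_ <-]; rewrite cmulA Xq.
have EBs i j : cstar (EB i j) = EB j i by rewrite /EB cstarM cstarK.
rewrite Ea0; apply: (matrix_units_nrm_le (blk := blk) (EB := EB)) => //.
- move=> i j k l [_ ij] [_ kl].
  have [vi si] := ixP i; have [vj sj] := ixP j.
  have [vk sk] := ixP k; have [vl sl] := ixP l.
  by rewrite (@pe_matrix_units _ _ _ _ n) // (inj_eq ixI).
- by move=> i j; rewrite cstarM cstarK.
- move=> i EB0; have := congr1 (fun u => cstar (X i) ** (u ** X i)) EB0.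
  rewrite /EB cmul0l cmul0r -cmulA XM // eqxx Xq XM // eqxx.
  exact: q0.
- exact: nrm_ge0.
move=> b; rewrite -Ea0; pose P := [pred i | blk i == b].
pose Q := \sum_(i | P i) EB i i.
have PB i j : P i -> P j -> blk i = blk j by move=> /eqP -> /eqP ->.
have QX i : P i -> Q ** X i = X i.
  move=> Pi; rewrite /Q cmul_suml (bigD1 i) //= [X in _ + X]big1 ?addr0.
    by rewrite /EB -cmulA XM // eqxx Xq.
  move=> j /andP[Pj ji]; rewrite /EB -cmulA XM ?(negPf ji) ?cmul0r //.
  exact: PB.
have Qp : projection Q.
  split; last by rewrite /Q cstar_sum; apply: eq_bigr => i _; rewrite EBs.
  rewrite {2}/Q cmul_sumr; apply: eq_bigr => i Pi.
  by rewrite /EB cmulA QX.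
apply: le_trans (nrm_compress_le (f (a0 + a1)) Qp).
rewrite le_eqVlt; apply/orP; left; apply/eqP; congr nrm.
rewrite /cmx_val {1}/Q !cmul_suml; apply: eq_bigr => i Pi.
rewrite /Q cmul_sumr; apply: eq_bigr => j Pj.
have [vi si] := ixP i; have [vj sj] := ixP j.
have [lij pij] := PB _ _ Pi Pj.
suff H : cstar (X i) ** f (a0 + a1) ** X j =
    c i j *: q (pend (psrc (ix j)) (lam (psrc (ix j)))).
  rewrite /EB -!cmulA.
  have -> : cstar (X i) ** (f (a0 + a1) ** (X j ** cstar (X j)))
     = (cstar (X i) ** f (a0 + a1) ** X j) ** cstar (X j) by rewrite !cmulA.
  rewrite H cmulZl cmulZr; congr (_ *: _); congr (_ ** _).
  have := congr1 (@cstar R B) (Xq j); rewrite cstarM (vert_star qt_TCK).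
  by move=> ->.
rewrite (hom_D fh) cmulDr cmulDl [X in _ + X](_ : _ = 0) ?addr0; last first.
  elim: oa1 => [|d w a [k k0 mw] _ IH].
    by rewrite (hom_0 fh) cmul0r cmul0l.
  rewrite (hom_D fh) (hom_Z fh) cmulDr cmulDl IH addr0 cmulZr cmulZl.
  by rewrite (ext_offdiag qt_TCK lamP k0 (hom_mono mw)) ?scaler0.
pose Y := pelt q t (psrc (ix i)) (lam (psrc (ix i))).
have Xk k : cstar (X i) ** pe q t (ix k) = if k == i then cstar Y else 0.
  have [vk sk] := ixP k; rewrite /X (ext_cat qt_TCK lamP) cstarM -cmulA.
  rewrite (stop_starM qt_TCK vi vk si sk) (inj_eq ixI) eq_sym.
  case: eqP => _; last by rewrite cmul0r.
  rewrite -(vert_star qt_TCK) -cstarM (pelt_rng qt_TCK) //.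
  by have [] := lamP (psrc (ix i)).
have Xl l : cstar (pe q t (ix l)) ** X j = if l == j then Y else 0.
  have [vl sl] := ixP l; rewrite /X (ext_cat qt_TCK lamP) cmulA.
  rewrite (stop_starM qt_TCK vl vj sl sj) (inj_eq ixI).
  case: eqP => [->|_]; last by rewrite cmul0l.
  rewrite (pelt_rng qt_TCK) /Y ?pij //.
  by have [] := lamP (psrc (ix j)).
rewrite Ea0 /cmx_val (hom_sum fh) cmul_sumr cmul_suml (bigD1 i) //=.
rewrite [X in _ + X]big1 ?addr0; last first.
  move=> k ki; rewrite (hom_sum fh) cmul_sumr cmul_suml big1 // => l _.
  rewrite (hom_Z fh) (hom_M fh) (hom_star fh) !hom_pe cmulZr cmulZl cmulA Xk.
  by rewrite (negPf ki) !cmul0l scaler0.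
rewrite (hom_sum fh) cmul_sumr cmul_suml (bigD1 j) //=.
rewrite [X in _ + X]big1 ?addr0; last first.
  move=> l lj; rewrite (hom_Z fh) (hom_M fh) (hom_star fh) !hom_pe.
  rewrite cmulZr cmulZl.
  by rewrite -!cmulA Xl (negPf lj) !cmul0r scaler0.
rewrite (hom_Z fh) (hom_M fh) (hom_star fh) !hom_pe cmulZr cmulZl.
rewrite cmulA -cmulA Xk Xl !eqxx /Y (pelt_starM qt_TCK) ?pij //.
by have [] := lamP (psrc (ix j)).
Qed.

(** Each homogeneous component [b_i] of [a] satisfies [|b_i| <= |f a|], because
    [b_i^* b_i] is the diagonal part of [b_i^* a]. *)
Lemma nrm_level_le n a : level p s n a -> nrm a <= (2 * n).+1%:R * nrm (f a).
Proof.
move=> /level_grading[b bg Ea].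
have fa0 := nrm_ge0 (f a).
have bi (i : 'I_(2 * n).+1) : nrm (b i) <= nrm (f a).
  have H : nrm (cstar (b i) ** b i) <= nrm (f (cstar (b i) ** a)).
    have -> : cstar (b i) ** a = cstar (b i) ** b i +
        \sum_(j < (2 * n).+1 | j != i) cstar (b i) ** b j.
      by rewrite Ea cmul_sumr (bigD1 i).
    apply: (@nrm_graded0_le (n + n)).
      have := graded_mul ps_TCK (graded_star (bg i)) (bg i).
      by rewrite addNr.
    rewrite -big_filter; apply: lspan_sum => j.
    rewrite mem_filter => /andP[ji _].
    have := graded_mul ps_TCK (graded_star (bg i)) (bg j).
    apply: lspan_bind => w mw; apply: lspan_in.
    exists (- (i%:Z - n%:Z) + (j%:Z - n%:Z)) => //.
    move: ji; rewrite -val_eqE /=; lia.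
  move: H; rewrite nrm_starM (hom_M fh) (hom_star fh) => H.
  have := nrmM (cstar (f (b i))) (f a); rewrite nrm_star.
  have := hom_contractive fh (b i); have := nrm_ge0 (b i).
  have := nrm_ge0 (f (b i)); nra.
rewrite {1}Ea; apply: le_trans (nrm_sum _ _ _) _.
apply: le_trans (ler_sum _ (fun i _ => bi i)) _.
by rewrite sumr_const card_ord mulr_natl.
Qed.

(** Applied to powers of [a^* a] the bound only grows linearly, so the constant
    disappears. *)
Lemma hom_level_isometric n a : level p s n a -> nrm (f a) = nrm a.
Proof.
have lek m h : level p s m h -> selfadj h -> nrm h <= nrm (f h).
  move=> lh hsa; apply: (@le_of_growth _ _ _ (2 * m).+1%:R).
    exact: nrm_ge0.
  move=> j; have fhsa : selfadj (f h) by rewrite /selfadj -(hom_star fh) hsa.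
  have [_ <-] := nrm_sqs j hsa; have [_ <-] := nrm_sqs j fhsa.
  have lj : level p s (2 ^ j * m) (sqs j h).
    elim: j => [|j IH]; first by rewrite mul1n.
    by rewrite expnS mul2n -addnn mulnDl; apply: (level_mul ps_TCK).
  have fj : f (sqs j h) = sqs j (f h).
    by elim: j {lj} => //= j IH; rewrite (hom_M fh) IH.
  apply: le_trans (nrm_level_le lj) _; rewrite fj ler_wpM2r ?nrm_ge0 //.
  rewrite -natrX -natrM ler_nat; have := expn_gt0 2 j; nia.
move=> la; apply/eqP; rewrite eq_le (hom_contractive fh) /=.
rewrite -(@ler_pXn2r _ 2) ?nnegrE ?nrm_ge0 // -!nrm_starM.
rewrite -(hom_star fh) -(hom_M fh).
apply: (lek (n + n)%N); last exact: selfadj_starM.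
exact: (level_mul ps_TCK (level_star la) la).
Qed.

End DiagonalBound.

(** * Generated subalgebras and ranges *)

Section Generation.
Variables (R : realType) (A : cstarAlgType R).
Implicit Types (D S : set A) (x y : A).

Lemma closed_of_approx D :
  (forall x,
    (forall e : R, 0 < e -> exists2 y, D y & nrm (x - y) < e) -> D x) ->
  closed D.
Proof.
move=> H x clx; apply: H => e e0.
have e0C : 0 < e%:C by rewrite ltcR.
have [y [Dy]] := clx _ (nbhsx_ballx x _ e0C).
by rewrite -ball_normE /= normE ltcR => xy; exists y.
Qed.

Lemma cstar_gen_ind S D : sub_cstar D -> S `<=` D -> cstar_gen S = setT ->
  forall x, D x.
Proof.
move=> subD SD genS x; have : cstar_gen S x by rewrite genS.
by apply.
Qed.

Lemma sub_cstar_approx D : D 0 -> (forall x y, D x -> D y -> D (x + y)) ->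
  (forall (c : R[i]) x, D x -> D (c *: x)) ->
  (forall x y, D x -> D y -> D (x ** y)) -> (forall x, D x -> D (cstar x)) ->
  sub_cstar [set x | forall e : R, 0 < e -> exists2 y, D y & nrm (x - y) < e].
Proof.
move=> D0 DD DZ DM Ds; split.
  by move=> e e0; exists 0; rewrite ?subrr ?nrm0.
split; [|split; [|split; [|split]]].
- move=> x y Dx Dy e e0; have e20 : 0 < e / 2 by rewrite divr_gt0.
  have [x' Dx' xx'] := Dx _ e20; have [y' Dy' yy'] := Dy _ e20.
  exists (x' + y'); first exact: DD.
  rewrite opprD addrACA; apply: le_lt_trans (nrmD _ _) _; lra.
- move=> c x Dx e e0; have c0 := nrm_ge0 c.
  have ec0 : 0 < e / (nrm c + 1) by rewrite divr_gt0 // ltr_wpDl.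
  have [x' Dx' xx'] := Dx _ ec0; exists (c *: x'); first exact: DZ.
  rewrite -scalerBr nrmZ; move: xx'; rewrite ltr_pdivlMr ?ltr_wpDl //.
  have := nrm_ge0 (x - x'); nra.
- move=> x y Dx Dy e e0; have x0 := nrm_ge0 x; have y0 := nrm_ge0 y.
  pose d := Num.min 1 (e / (nrm x + nrm y + 2)).
  have den : 0 < nrm x + nrm y + 2 by lra.
  have d0 : 0 < d by rewrite lt_min ltr01 divr_gt0.
  have d1 : d <= 1 by rewrite ge_min lexx.
  have de : d * (nrm x + nrm y + 2) <= e.
    by rewrite -ler_pdivlMr // ge_min lexx orbT.
  have [x' Dx' xx'] := Dx _ d0; have [y' Dy' yy'] := Dy _ d0.
  exists (x' ** y'); first exact: DM.
  have -> : x ** y - x' ** y' = x ** (y - y') + (x - x') ** y'.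
    by rewrite cmulBr cmulBl; abel.
  have y'1 : nrm y' <= nrm y + 1.
    rewrite -[y'](subrK y); have := nrmD (y' - y) y; rewrite nrmBC; lra.
  apply: le_lt_trans (nrmD _ _) _.
  have := nrmM x (y - y'); have := nrmM (x - x') y'.
  have := nrm_ge0 (x - x'); have := nrm_ge0 (y - y'); have := nrm_ge0 y'; nra.
- move=> x Dx e e0; have [x' Dx' xx'] := Dx _ e0.
  by exists (cstar x'); [exact: Ds | rewrite -cstarB nrm_star].
- apply: closed_of_approx => x Hx e e0.
  have e20 : 0 < e / 2 by rewrite divr_gt0.
  have [y Dy xy] := Hx _ e20; have [z Dz yz] := Dy _ e20.
  exists z => //; rewrite -[x](subrK y) -addrA.
  apply: le_lt_trans (nrmD _ _) _; lra.
Qed.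

End Generation.

Section IsometricRange.
Variables (R : realType) (A B : cstarAlgType R) (f : A -> B).
Hypotheses (fh : star_hom f) (fiso : forall x, nrm (f x) = nrm x).

Lemma range_sub_cstar : sub_cstar (range f).
Proof.
split; first by exists 0; rewrite ?(hom_0 fh).
split; [|split; [|split; [|split]]].
- by move=> _ _ [x _ <-] [y _ <-]; exists (x + y); rewrite ?(hom_D fh).
- by move=> c _ [x _ <-]; exists (c *: x); rewrite ?(hom_Z fh).
- by move=> _ _ [x _ <-] [y _ <-]; exists (x ** y); rewrite ?(hom_M fh).
- by move=> _ [x _ <-]; exists (cstar x); rewrite ?(hom_star fh).
apply: closed_of_approx => y Hy.
have h0 n : 0 < (2^-1 : R) ^+ n by rewrite exprn_gt0 ?invr_gt0.
have /choice[u uP] n : exists x, nrm (y - f x) < 2^-1 ^+ n.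
  by have [_ [x _ <-] xy] := Hy _ (h0 n); exists x.
have small (e : R) : 0 < e ->
    exists N, forall n, (N <= n)%N -> (2^-1 : R) ^+ n < e.
  by apply: expr_lt_eps; rewrite ?invr_ge0 // invf_lt1 // ltr1n.
have [e e0|l ul] := @cauchy_limit R A u.
  have e20 : 0 < e / 2 by rewrite divr_gt0.
  have [N HN] := small _ e20; exists N => n Nn.
  rewrite -fiso (hom_B fh) -[f (u n)](subrK y) -addrA.
  have := nrmD (f (u n) - y) (y - f (u N)); rewrite nrmBC.
  have := uP n; have := uP N; have := HN _ Nn; have := HN _ (leqnn N); lra.
exists l => //; apply/eqP; rewrite -subr_eq0; apply/eqP.
apply: (@nrm_small_eq0 R B _ 2) => e e0.
have [N HN] := small _ e0; have [M HM] := ul _ e0.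
have := HN _ (leq_maxl N M); have := HM _ (leq_maxr N M).
set n := maxn N M => H1 H2; have := uP n.
have -> : f l - y = (f l - f (u n)) + (f (u n) - y) by abel.
have := nrmD (f l - f (u n)) (f (u n) - y).
rewrite -(hom_B fh) fiso (nrmBC l) (nrmBC _ y); lra.
Qed.

Lemma isometric_bijective : range f = setT -> bijective f.
Proof.
move=> fT; have /choice[g fg] y : exists x, f x = y.
  have [x _ fx] : range f y by rewrite fT.
  by exists x.
exists g => // x; apply/eqP; rewrite -subr_eq0 -nrm_eq0 -fiso (hom_B fh) fg.
by rewrite subrr nrm0.
Qed.

End IsometricRange.

(** * The Cuntz-Krieger uniqueness theorem *)

Section CuntzKriegerUniqueness.
Variables (R : realType) (E : digraph) (A B : cstarAlgType R).
Variables (p : vert E -> A) (s : edge E -> A).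
Variables (q : vert E -> B) (t : edge E -> B) (f : A -> B).

Lemma vert_level : TCK_family p s -> forall v, level p s 0 (p v).
Proof.
move=> H v; apply: lspan_in; exists 0, (v, [::]), (v, [::]); split=> //.
by rewrite /pe /= (vert_star H) (vert_idem H).
Qed.

Lemma edge_level : TCK_family p s -> forall e, level p s 1 (s e).
Proof.
move=> H e; apply: lspan_in; exists 1, (rng e, [:: e]), (src e, [::]).
split=> //; first by split=> //; rewrite /valid /= eqxx.
by rewrite /pe /= (vert_star H) -cmulA (vert_idem H) (edge_src H).
Qed.

(** The norms agree on the dense span of the [s_mu s_nu^*], and [f] is
    continuous because it is contractive. *)
Theorem cuntz_krieger_uniqueness : row_finite E ->
  (forall mu : seq (edge E), is_cycle mu -> ~ no_entrance mu) ->
  CK_family p s -> TCK_family q t -> (forall v, q v <> 0) ->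
  family_cstar p s = setT ->
  star_hom f -> (forall v, f (p v) = q v) -> (forall e, f (s e) = t e) ->
  forall x, nrm (f x) = nrm x.
Proof.
move=> rowE ent psCK qtT q0 gen fh fp fs x; have psT := psCK.1.
pose D : set A := [set a | exists n, level p s n a].
have subD : sub_cstar [set x | forall e : R, 0 < e ->
    exists2 y, D y & nrm (x - y) < e].
  apply: sub_cstar_approx.
  - by exists 0%N; exact: Lspan0.
  - move=> a b [n la] [m lb]; exists (maxn n m); apply: lspanD.
      exact: level_le (leq_maxl _ _) la.
    exact: level_le (leq_maxr _ _) lb.
  - by move=> c a [n la]; exists n; exact: lspanZ.
  - by move=> a b [n la] [m lb]; exists (n + m)%N; exact: level_mul.
  - by move=> a [n la]; exists n; exact: level_star.
have genD : range p `|` range s `<=` [set x | forall e : R, 0 < e ->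
    exists2 y, D y & nrm (x - y) < e].
  move=> a ga e e0; exists a; last by rewrite subrr nrm0.
  case: ga => -[y _ <-]; first by exists 0%N; exact: vert_level.
  by exists 1%N; exact: edge_level.
have Dx := cstar_gen_ind subD genD gen x.
apply/eqP; rewrite eq_le (hom_contractive fh) /=; apply/ler_addgt0Pr => e e0.
have e20 : 0 < e / 2 by rewrite divr_gt0.
have [y [n ly] xy] := Dx _ e20.
have E1 := hom_level_isometric rowE ent psCK qtT q0 fh fp fs ly.
have := nrmD (x - y) y; rewrite subrK.
have := nrmD (f y - f x) (f x); rewrite subrK -(hom_B fh).
have := hom_contractive fh (y - x); rewrite [nrm (y - x)]nrmBC; lra.
Qed.

End CuntzKriegerUniqueness.

(** * The cut graph *)

Section CutGraph.
Variables (E : digraph) (X : set (edge E)).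
Hypothesis hX : cutting_set X.

Notation F := (cut_graph X).

Lemma cut_edge_unentered x e : X x -> rng e = rng x -> e = x.
Proof.
move=> Xx; have [C [mu [_ nomu ->]] [nu [k ->] xnu]] := hX.1 _ Xx.
by apply: nomu; rewrite mem_rot in xnu.
Qed.

Lemma cut_edge_cycle x : X x -> exists mu,
  [/\ is_cycle (x :: mu), no_entrance (x :: mu) &
      forall e, e \in mu -> e \notin X].
Proof.
move=> Xx; have [C CC [nu Cnu xnu]] := hX.1 _ Xx.
have [x0 XC] := hX.2 _ CC.
have [mu [[mu0 cmu umu] nomu EC]] := CC.
move: Cnu xnu; rewrite EC => -[k ->]; rewrite mem_rot => xmu.
have [i m Em] := rot_to xmu.
exists m; split.
- split=> //; first by rewrite -Em rot_cycle.
  by rewrite -Em map_rot rot_uniq.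
- by move=> e f; rewrite -Em mem_rot; exact: nomu.
move=> e em; rewrite notin_setE => Xe.
have inC f : f \in mu -> class_edges C f.
  by move=> fmu; exists mu => //; rewrite EC; exists 0%N; rewrite rot0.
have onlyx f : f \in mu -> X f -> f = x0.
  move=> fmu Xf; have : (X `&` class_edges C) f by split=> //; exact: inC.
  by rewrite XC.
have emu : e \in mu by rewrite -(mem_rot i) Em inE em orbT.
have ex : e = x by rewrite (onlyx _ emu Xe) (onlyx _ xmu Xx).
have : uniq [seq src e | e <- x :: m] by rewrite -Em map_rot rot_uniq.
by move=> /= /andP[/mapP[]]; exists x => //; rewrite -ex.
Qed.

(** A cycle of the cut graph without an entrance would be one of the
    entranceless cycles of [E], and these have all been cut. *)
Lemma cut_graph_entrances (mu : seq (edge F)) : is_cycle mu -> ~ no_entrance mu.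
Proof.
move=> [mu0 cmu umu] nomu; pose nu : seq (edge E) := [seq val e | e <- mu].
have cyc : is_cycle nu.
  split; first by rewrite -size_eq0 size_map size_eq0.
    by rewrite cycle_map.
  by rewrite -map_comp.
have nonu : no_entrance nu.
  move=> e f /mapP[f' f'mu ->] ref.
  have [Xe|nXe] := pselect (X e).
    by rewrite (cut_edge_unentered Xe (esym ref)).
  have he : e \notin X by rewrite notin_setE.
  by rewrite -(nomu (Sub e he) f').
have [x XC] := hX.2 (cycle_class nu) (ex_intro _ nu (And3 cyc nonu erefl)).
have : (X `&` class_edges (cycle_class nu)) x by rewrite XC.
move=> [Xx [_ [k ->]]]; rewrite mem_rot => /mapP[x' _ Ex].
by have := valP x'; rewrite -Ex notin_setE.
Qed.

Lemma cut_graph_row_finite : row_finite E -> row_finite F.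
Proof.
move=> rowE v; apply: (@finite_preimage _ _ [set e : edge E | rng e = v] val).
  by move=> e f _ _; exact: val_inj.
exact: rowE.
Qed.

Section CutFamily.
Variables (R : realType) (B : cstarAlgType R).
Variables (q : vert E -> B) (t : edge E -> B).

Lemma cut_sum (G : set (edge F)) :
  \sum_(e \in [set val f | f in G]) (t e ** cstar (t e)) =
  \sum_(f \in G) (t (val f) ** cstar (t (val f))).
Proof. by apply: fsbig_image => e f _ _; exact: val_inj. Qed.

Lemma cut_TCK : TCK_family q t -> @TCK_family R F B q (fun f => t (val f)).
Proof.
move=> [Hp Hs T3]; split; [exact: Hp | by move=> f; exact: Hs |].
move=> v G fG GF; rewrite -cut_sum; apply: T3; first exact: finite_image.
by move=> _ [f Gf <-]; exact: GF.
Qed.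

(** A vertex that receives an edge of the cut graph receives no cut edge, so
    the Cuntz-Krieger sums agree. *)
Lemma cut_CK : CK_family q t -> @CK_family R F B q (fun f => t (val f)).
Proof.
move=> [HT CK]; split; first exact: cut_TCK.
move=> v [f0 rf0] fin; rewrite -cut_sum.
have EF : [set val f | f in [set f : edge F | rng f = v]] =
    [set e : edge E | rng e = v].
  apply/seteqP; split=> [_ [f fv <-] //|e /= ev].
  have [Xe|nXe] := pselect (X e).
    have ef : val f0 = e by apply: (cut_edge_unentered Xe); rewrite ev -rf0.
    by have := valP f0; rewrite ef notin_setE.
  have he : e \notin X by rewrite notin_setE.
  by exists (Sub e he).
rewrite EF; apply: CK; first by exists (val f0).
rewrite -EF; exact: finite_image.
Qed.

End CutFamily.
End CutGraph.

(** * Normalised entranceless cycles *)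

Section NormalisedCycle.
Variables (R : realType) (E : digraph) (B : cstarAlgType R).
Variables (q : vert E -> B) (t : edge E -> B).
Hypothesis qt_CK : CK_family q t.

Lemma foldl_cmul a v mu : vpath v mu -> a ** q v = a ->
  foldl (@cmul R B) a [seq t e | e <- mu] = a ** pelt q t v mu.
Proof.
elim: mu v a => [|e mu IH] v a /=; first by move=> _ ->.
move=> /andP[_ vmu] av; rewrite (IH (src e)) ?cmulA //.
by rewrite -cmulA (edge_src qt_CK.1).
Qed.

Lemma pelt_unitary v mu : vpath v mu ->
  (forall e f : edge E, f \in mu -> rng e = rng f -> e = f) ->
  pelt q t v mu ** cstar (pelt q t v mu) = q v.
Proof.
elim: mu v => [|f mu IH] v /=.
  by move=> _ _; rewrite (vert_star qt_CK.1) (vert_idem qt_CK.1).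
move=> /andP[/eqP rf vmu] nomu.
rewrite cstarM -cmulA [pelt _ _ _ _ ** _]cmulA IH //; last first.
  by move=> e g gmu; apply: nomu; rewrite inE gmu orbT.
rewrite cmulA (edge_src qt_CK.1).
have Ef : [set e : edge E | rng e = v] = [set f].
  apply/seteqP; split=> [e /= ev|e /= ->] //.
  by apply: nomu; rewrite ?mem_head // rf.
rewrite (qt_CK.2 v) ?Ef ?fsbig_set1 //; first by exists f.
Qed.

(** On a cycle [x mu] without an entrance [s_mu] is a unitary between corners,
    so [s_x s_mu = p] forces [s_x = s_mu^*]. *)
Lemma normalised_edge x mu : is_cycle (x :: mu) -> no_entrance (x :: mu) ->
  path_elt t x mu = q (rng x) -> t x = cstar (pelt q t (src x) mu).
Proof.
move=> [_ cyc _] nomu; move: cyc; rewrite /= cycle_path_vpath.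
move=> /andP[vmu /eqP emu].
rewrite /path_elt (foldl_cmul vmu) ?(edge_src qt_CK.1) // => norm.
rewrite -[t x](edge_src qt_CK.1) -(pelt_unitary vmu); last first.
  by move=> e f fmu; apply: nomu; rewrite inE fmu orbT.
rewrite cmulA norm -emu -(vert_star qt_CK.1 (pend _ _)) -cstarM.
by rewrite (pelt_src qt_CK.1).
Qed.

End NormalisedCycle.

Theorem lemma4p6 (R : realType) (E : digraph) (hE : row_finite E)
    (X : set (edge E)) (hX : cutting_set X)
    (A : cstarAlgType R)
    (p : vert (cut_graph X) -> A) (s : edge (cut_graph X) -> A)
    (hA : graph_cstar p s)
    (B : cstarAlgType R) (pm : vert E -> B) (sm : edge E -> B)
    (hB : co_universal_cstar pm sm) :
  exists phi : A -> B,
    [/\ star_iso phi,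
        (forall v : vert E, phi (p (zeta_vert X v)) = pm v)
      & (forall (e : edge E) (he : e \notin X),
           phi (s (zeta_edge he)) = sm e)].
Proof.
have [psCK genA univA] := hA; have [[qtCK norm] genB pm0 _] := hB.
have cutCK := cut_CK hX qtCK.
have [phi [phih phip phis]] := univA B _ _ cutCK.
have iso := cuntz_krieger_uniqueness (cut_graph_row_finite (X := X) hE)
  (cut_graph_entrances hX) psCK cutCK.1 pm0 genA phih phip phis.
have subR := range_sub_cstar phih iso.
have rp v : range phi (pm v) by exists (p v).
have rs e : e \notin X -> range phi (sm e).
  by move=> he; exists (s (Sub e he)); rewrite ?phis.
have rpelt v mu : (forall e, e \in mu -> e \notin X) ->
    range phi (pelt pm sm v mu).
  elim: mu v => [|e mu IH] v nX /=; first exact: rp.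
  have [_ [_ [_ [rM _]]]] := subR; apply: rM; first exact/rs/nX/mem_head.
  by apply: IH => f fmu; apply: nX; rewrite inE fmu orbT.
exists phi; split=> //.
split=> //; apply: (isometric_bijective phih iso); apply/seteqP; split=> // y _.
apply: (cstar_gen_ind subR _ genB) => _ [] [z _ <-]; first exact: rp.
have [Xz|nXz] := pselect (X z); last by apply: rs; rewrite notin_setE.
have [mu [cyc nomu nX]] := cut_edge_cycle hX Xz.
rewrite (normalised_edge qtCK cyc nomu (norm _ _ cyc nomu)).
have [_ [_ [_ [_ [rstar _]]]]] := subR; exact/rstar/rpelt.
Qed.
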